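(* There exists a tournament on $8$ vertices that is intrinsically linked as a directed graph.
   Context: A tournament on $n$ vertices is a directed graph on $n$ vertices with exactly one directed edge between each pair of distinct vertices (equivalently, the complete graph $K_n$ with a choice of orientation of each edge). Embeddings are embeddings of the graph in $S^3$, in the usual (tame) sense of spatial graph theory. A cycle in a directed graph means a cycle of the underlying undirected graph; it is consistently oriented if its edges all point the same way around the cycle (i.e. it is a directed cycle). A directed graph $G$ is intrinsically linked as a directed graph (digraph) if every embedding of $G$ in $S^3$ contains a non-split link (with at least two components), formed by pairwise disjoint cycles of $G$, each of which is consistently oriented. *)

(* Defs.v *)
From HB Require Import structures.
From mathcomp Require Import all_boot all_order all_algebra.
From mathcomp Require Import all_classical all_reals all_analysis.

Set Implicit Arguments.
Unset Strict Implicit.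
Unset Printing Implicit Defensive.

Import Order.TTheory GRing.Theory Num.Theory.
Import numFieldNormedType.Exports.
Local Open Scope classical_set_scope.
Local Open Scope ring_scope.

Record digraph (V : finType) := Digraph {
  adj :> rel V;
  adj_irr : irreflexive adj
}.

Definition tournament (V : finType) (G : digraph V) : Prop :=
  forall u v : V, u != v -> G u v (+) G v u.

(* A consistently oriented cycle, listed in the order in which it is traversed.
   As G has no loops, such a list has at least two entries, and at least three
   if G is a tournament. *)
Definition directed_cycle (V : finType) (G : digraph V) (c : seq V) : bool :=
  (c != [::]) && ucycleb G c.

Definition homeomorphism (T U : topologicalType) (A : set T) (B : set U)
    (f : T -> U) : Prop :=
  [/\ {within A, continuous f}, set_bij A B f &
      exists g : U -> T, {within B, continuous g} /\ {in A, cancel f g}].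

Definition embedding (T U : topologicalType) (A : set T) (B : set U)
    (f : T -> U) : Prop :=
  f @` A `<=` B /\ homeomorphism A (f @` A) f.

Definition sphere (R : realType) (n : nat) : set 'rV[R]_n.+1 :=
  [set x | \sum_i x ord0 i ^+ 2 = 1].
Arguments sphere : clear implicits.

(* The vertices p i are allowed to be affinely dependent, so that this is a
   simplex of dimension at most k. *)
Definition simplex (R : realType) (n k : nat) (p : 'I_k.+1 -> 'rV[R]_n) :
    set 'rV[R]_n :=
  [set x | exists w : 'I_k.+1 -> R,
     [/\ forall i, 0 <= w i, \sum_i w i = 1 & x = \sum_i w i *: p i]].

Definition polyhedron (R : realType) (n k : nat) (Q : set 'rV[R]_n) : Prop :=
  exists2 F : set ('I_k.+1 -> 'rV[R]_n),
    finite_set F & Q = \bigcup_(p in F) simplex p.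

(* The sets X in the family are simultaneously carried to polyhedra of
   dimension at most k by a homeomorphism h from S^3 minus a point q to R^3.
   Such an h is the same thing as a homeomorphism of S^3 = R^3 U {oo} (it
   extends by q |-> oo), so this is the usual notion of tameness: equivalence
   under a homeomorphism of S^3 to something piecewise linear. *)
Definition tame (R : realType) (k : nat) (F : set (set 'rV[R]_4)) : Prop :=
  exists (q : 'rV[R]_4) (h : 'rV[R]_4 -> 'rV[R]_3),
    [/\ sphere R 3 q,
        homeomorphism (sphere R 3 `\ q) [set: 'rV[R]_3] h &
        forall X, F X -> ~ X q /\ polyhedron k (h @` X)].

Section Spatial.
Variables (R : realType) (V : finType) (G : digraph V).
(* gamma u v is only relevant when G has an arc from u to v; the arc is then
   embedded as the image of [0, 1]. *)
Variables (f : V -> 'rV[R]_4) (gamma : V -> V -> R -> 'rV[R]_4).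

Definition arc_image (u v : V) : set 'rV[R]_4 := gamma u v @` `[0, 1].

Record spatial_embedding : Prop := SpatialEmbedding {
  vertex_in : forall v, sphere R 3 (f v);
  vertex_inj : injective f;
  arc_embedding : forall u v, G u v ->
    embedding (`[0, 1] : set R) (sphere R 3) (gamma u v);
  arc_source : forall u v, G u v -> gamma u v 0 = f u;
  arc_target : forall u v, G u v -> gamma u v 1 = f v;
  arc_avoids_vertex : forall u v w (t : R), G u v -> 0 < t < 1 ->
    gamma u v t <> f w;
  arc_avoids_arc : forall u v u' v' (s t : R), G u v -> G u' v' ->
    (u, v) != (u', v') -> 0 < s < 1 -> 0 < t < 1 ->
    gamma u v s <> gamma u' v' t
}.

Definition tame_embedding : Prop :=
  spatial_embedding /\
  tame 1 [set X | exists u v, G u v /\ X = arc_image u v].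

Definition cycle_image (c : seq V) : set 'rV[R]_4 :=
  \bigcup_(u in [set` c]) arc_image u (next c u).

End Spatial.

Definition tame_2sphere (R : realType) (S : set 'rV[R]_4) : Prop :=
  (exists2 s : 'rV[R]_3 -> 'rV[R]_4,
     embedding (sphere R 2) (sphere R 3) s & S = s @` sphere R 2)
  /\ tame 2 [set S].

(* L is the set of components of a link in S^3. It is split if some tame
   2-sphere in the complement of the link has components of the link on both
   sides, i.e. two of them lie in different components of S^3 minus S. *)
Definition split_link (R : realType) (L : set (set 'rV[R]_4)) : Prop :=
  exists S : set 'rV[R]_4,
    [/\ tame_2sphere S,
        forall K, L K -> K `&` S = set0 &
        exists K1 K2, [/\ L K1, L K2 &
          forall x y, K1 x -> K2 y ->
            ~ connected_component (sphere R 3 `\` S) x y]].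

Definition intrinsically_linked (R : realType) (V : finType) (G : digraph V) :
    Prop :=
  forall (f : V -> 'rV[R]_4) (gamma : V -> V -> R -> 'rV[R]_4),
    tame_embedding G f gamma ->
    exists L : seq (seq V),
      [/\ (1 < size L)%N,
          all (directed_cycle G) L,
          pairwise (fun c d : seq V => ~~ has (mem c) d) L &
          ~ split_link [set cycle_image gamma c | c in [set` L]]].

(* Main.v *)
Require Import Defs.
From mathcomp Require Import all_boot all_order all_algebra.
From mathcomp Require Import all_classical all_reals all_analysis.
From mathcomp Require Import ring lra.

Set Implicit Arguments.
Unset Strict Implicit.
Unset Printing Implicit Defensive.

Import Order.TTheory GRing.Theory Num.Theory.
Import numFieldNormedType.Exports.
Local Open Scope ring_scope.

(** Every embedding of the tournament below carries two disjoint directed cycles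
    whose mod 2 linking number is odd.  As in the Conway-Gordon theorem, one sums
    the linking numbers over a list of pairs of disjoint directed cycles in which
    each unordered pair of disjoint arcs is met an even number of times: comparing
    an embedding with the straight embedding on the moment curve changes the
    linking number of a pair by one term for each pair of arcs, and these terms
    cancel.  The sum is therefore the same for all embeddings, and it is 1 on
    the moment curve.

    Linking numbers are computed on fine polygonal approximations in general
    position in R^3, by counting crossings of triangles with edges.  Suppose a
    sphere S separates the components K1 and K2.  Contract K1 along a cone, and
    whenever the cone leaves the component of the complement of S that contains
    K1, follow instead a contraction of S minus a point, which takes place on S.
    This null-homotopy of K1 need not be continuous, but on a fine grid it moves in
    small steps; so it yields a chain of small triangles bounded by K1 and
    disjoint from K2, and the linking number vanishes. *)

(** * Radon partitions of points in space *)

(** Everything rests on one fact: for disks [F] and [F'] with disjoint vertices in general position,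
    the number of crossings of [F] with the boundary of [F'] is, modulo 2, symmetric in [F] and
    [F']. The count therefore depends only on the two boundaries, so no invariance under isotopy or
    under a change of disk has to be proved; the terms attached to pairs of arcs become symmetric in
    the two arcs, which is what lets them cancel; and a disk of one component can be traded for a
    chain spanned by the other. The symmetry holds triangle by triangle, and there it is a statement
    about the signs of orientations of six points, settled in their Gale diagram in the plane. In
    the split case the obstacle is to contract [K1] away from [K2] without a description of the two
    sides of the sphere. What is explicit is a contraction of the sphere minus a point, carried over
    by its parametrisation. Points of the cone are sent to nearby points of the sphere by an
    arbitrary choice, whence the discontinuity. The removed point must stay off the cone: it is put
    at infinity if the sphere passes there, and otherwise a generic apex avoids it because [K1] is
    polygonal. *)

Definition source (R : realFieldType) (V : finType) (D : V -> V -> R) v :=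
  [forall w, (w != v) ==> (0 < D v w)].

Definition sink (R : realFieldType) (V : finType) (D : V -> V -> R) v :=
  [forall w, (w != v) ==> (D v w < 0)].

(** A source [s] puts all other vectors in the open half-plane on one side of [s]. There [0 < D a b]
    is transitive, by the three-term Plücker relation, so a vertex with the most predecessors is a
    sink. *)
Lemma sink_of_source (R : realFieldType) (V : finType) (D : V -> V -> R) :
  (forall v w, D v w = - D w v) ->
  (forall v w, v != w -> D v w != 0) ->
  (forall s a b c, D s a * D b c - D s b * D a c + D s c * D a b = 0) ->
  [exists v, source D v] -> [exists v, sink D v].
Proof.
move=> Danti Dneq0 Dpl /existsP [s /forallP hs].
have hs' w : w != s -> 0 < D s w by move=> h; move: (hs w); rewrite h.
have tr a b c : 0 < D a b -> 0 < D b c -> 0 < D a c.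
  move=> ab bc.
  have Dxx x : D x x = 0 by have := Danti x x; lra.
  have [eb|nb] := eqVneq b s.
    have [ea|na] := eqVneq a s; first by move: ab; rewrite ea eb Dxx ltxx.
    have := hs' _ na; rewrite -eb Danti; lra.
  have [->|na] := eqVneq a s.
    apply: (hs' c); apply: contraTneq bc => ->.
    have := hs' _ nb; rewrite Danti; lra.
  have [ec|nc] := eqVneq c s.
    have := hs' _ nb; move: bc; rewrite ec Danti; lra.
  have h := Dpl s a b c.
  have := hs' _ na; have := hs' _ nb; have := hs' _ nc => sc sb sa.
  suff : 0 < D s b * D a c by rewrite pmulr_rgt0.
  have -> : D s b * D a c = D s a * D b c + D s c * D a b by lra.
  by rewrite addr_gt0 // mulr_gt0.
pose N v := #|[set w | 0 < D w v]|.
case: (@arg_maxnP V s predT N isT) => v _ hv.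
apply/existsP; exists v; apply/forallP => w; apply/implyP => wv.
rewrite ltNge; apply/negP => h.
have vw : 0 < D v w by rewrite lt_def h Dneq0 // eq_sym.
have : (N w <= N v)%N := hv w isT.
rewrite leqNgt => /negP; apply.
apply: proper_card; apply/properP; split.
  by apply/fintype.subsetP => x; rewrite !inE => xv; apply: tr vw.
exists v; rewrite !inE //.
by have := Danti v v; case: ltP => //; lra.
Qed.

Lemma sourceN (R : realFieldType) (V : finType) (D : V -> V -> R) v :
  source (fun a b => - D a b) v = sink D v.
Proof. by apply: eq_forallb => w; rewrite oppr_gt0. Qed.

Lemma sinkN (R : realFieldType) (V : finType) (D : V -> V -> R) v :
  sink (fun a b => - D a b) v = source D v.
Proof. by apply: eq_forallb => w; rewrite oppr_lt0. Qed.

Lemma big_addb_uniq (V : finType) (P : pred V) :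
  (forall v w, P v -> P w -> v = w) ->
  \big[addb/false]_v P v = [exists v, P v].
Proof.
move=> h; case: (boolP [exists v, P v]) => [/existsP [v Pv]|].
  rewrite (bigD1 v) //= Pv big1 // => w wv.
  by apply: contraNF wv => Pw; rewrite (h w v).
by rewrite negb_exists => /forallP np; rewrite big1 // => v _; apply/negbTE.
Qed.

(* For D v w = det (g v) (g w) with g v in the plane, a source or a sink exists iff
   all the g v lie in an open half-plane, and then both exist. *)
Lemma even_source_sink (R : realFieldType) (V : finType) (D : V -> V -> R) :
  (forall v w, D v w = - D w v) ->
  (forall v w, v != w -> D v w != 0) ->
  (forall s a b c, D s a * D b c - D s b * D a c + D s c * D a b = 0) ->
  \big[addb/false]_v (source D v (+) sink D v) = false.
Proof.
move=> Danti Dneq0 Dpl; rewrite big_split /= !big_addb_uniq.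
- suff -> : [exists v, source D v] = [exists v, sink D v] by rewrite addbb.
  apply/idP/idP; first exact: sink_of_source.
  rewrite -(eq_existsb (sourceN D)) -(eq_existsb (sinkN D)) => h.
  apply: sink_of_source h.
  - by move=> v w; congr (- _); exact: Danti.
  - by move=> v w /Dneq0; rewrite oppr_eq0.
  - by move=> s a b c; rewrite !mulrNN.
- move=> v w /forallP hv /forallP hw; apply/eqP; apply/negPn/negP => vw.
  have := hv w; have := hw v; rewrite vw eq_sym vw /= (Danti w); lra.
- move=> v w /forallP hv /forallP hw; apply/eqP; apply/negPn/negP => vw.
  have := hv w; have := hw v; rewrite vw eq_sym vw /= (Danti w); lra.
Qed.

Section Orient.
Variable R : realFieldType.
Implicit Types a b c d e f : 'rV[R]_3.

Definition cx : 'I_3 := @Ordinal 3 0 isT.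
Definition cy : 'I_3 := @Ordinal 3 1 isT.
Definition cz : 'I_3 := @Ordinal 3 2 isT.

Definition det3 a b c : R :=
  a 0 cx * (b 0 cy * c 0 cz - b 0 cz * c 0 cy)
  - a 0 cy * (b 0 cx * c 0 cz - b 0 cz * c 0 cx)
  + a 0 cz * (b 0 cx * c 0 cy - b 0 cy * c 0 cx).

Definition orient a b c d : R := det3 (b - a) (c - a) (d - a).

Lemma orientE a b c d : orient a b c d =
  (b 0 cx - a 0 cx) * ((c 0 cy - a 0 cy) * (d 0 cz - a 0 cz) - (c 0 cz - a 0 cz) * (d 0 cy - a 0 cy))
  - (b 0 cy - a 0 cy) * ((c 0 cx - a 0 cx) * (d 0 cz - a 0 cz) - (c 0 cz - a 0 cz) * (d 0 cx - a 0 cx))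
  + (b 0 cz - a 0 cz) * ((c 0 cx - a 0 cx) * (d 0 cy - a 0 cy) - (c 0 cy - a 0 cy) * (d 0 cx - a 0 cx)).
Proof. by rewrite /orient /det3 !mxE. Qed.

(* The coefficients of the affine dependency of the five points, with the signs of
   the last two reversed. *)
Definition radon a b c d e : seq R :=
  [:: orient b c d e; - orient a c d e; orient a b d e;
      orient a b c e; - orient a b c d].

(* In general position, the triangle abc meets the segment de iff {abc | de} is the
   Radon partition of the five points. *)
Definition cross a b c d e : bool :=
  all (fun x => 0 < x) (radon a b c d e) (+) all (fun x => x < 0) (radon a b c d e).

Lemma crossC a b c d e : cross a b c d e = cross a b c e d.
Proof.
have sw x y z t : orient x y z t = - orient x y t z.
  by rewrite !orientE; ring.
rewrite /cross /radon /= (sw b c e d) (sw a c e d) (sw a b e d).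
rewrite !(oppr_gt0, oppr_lt0) !andbT.
by do !case: (_ < _).
Qed.

(** A negative factor [k] exchanges source and sink, which the exclusive or does not see; hence only
    proportionality to [radon] is required. *)
Lemma source_sink_cross (V : finType) (D : V -> V -> R) v (ws : seq V) (k : R) a b c d e :
  k != 0 -> (forall w, (w != v) = (w \in ws)) ->
  [seq D v w | w <- ws] = [seq k * x | x <- radon a b c d e] ->
  source D v (+) sink D v = cross a b c d e.
Proof.
move=> k0 hws hD.
have hall (P : pred R) : [forall w, (w != v) ==> P (D v w)] = all P [seq D v w | w <- ws].
  rewrite all_map; apply/forallP/allP => [h w|h w].
    by rewrite -hws => wv; have := h w; rewrite wv.
  by apply/implyP; rewrite hws => /h.
rewrite /source /sink (hall (fun x => 0 < x)) (hall (fun x => x < 0)) hD.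
rewrite /cross !all_map.
have [kp|kn|/eqP] := ltgtP 0 k; last by rewrite eq_sym (negPf k0).
  by congr addb; apply: eq_all => x /=; rewrite ?pmulr_rgt0 ?pmulr_rlt0.
by rewrite addbC; congr addb; apply: eq_all => x /=; rewrite ?nmulr_rgt0 ?nmulr_rlt0.
Qed.

(* The Gale diagram of six points: l and m are two dependencies, and row v of the
   resulting determinants is, up to a factor, the dependency avoiding point v.
   The sign s accounts for the split abc | def. *)
Definition gale a b c d e f (v w : nat) : R :=
  let l := [:: orient b c d e; - orient a c d e; orient a b d e;
               - orient a b c e; orient a b c d; 0] in
  let m := [:: orient b c d f; - orient a c d f; orient a b d f;
               - orient a b c f; 0; orient a b c d] in
  let s (u : nat) := if (u < 3)%N then 1 else -1 in
  s v * s w * (l`_v * m`_w - l`_w * m`_v).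

(** Leaving out a vertex of abc should give the crossing of def with the opposite edge, so rows 0,
    1, 2 are listed with 3, 4, 5 in front, as the triangle comes first in [radon]. *)
Lemma galeE a b c d e f (k := orient a b c d) :
  let r v := [seq gale a b c d e f v w | w <- [seq w <- [:: 3; 4; 5; 0; 1; 2]%N | w != v]] in
  let r' v := [seq gale a b c d e f v w | w <- [seq w <- [:: 0; 1; 2; 3; 4; 5]%N | w != v]] in
  [/\ r 0 = [seq - k * x | x <- radon d e f b c],
     r 1 = [seq k * x | x <- radon d e f a c],
     r 2 = [seq - k * x | x <- radon d e f a b] &
  [/\ r' 3 = [seq k * x | x <- radon a b c e f],
     r' 4 = [seq - k * x | x <- radon a b c d f] &
     r' 5 = [seq k * x | x <- radon a b c d e]]].
Proof.
rewrite /k /gale /radon /=.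
have seq5 (x y z t u x' y' z' t' u' : R) : x = x' -> y = y' -> z = z' -> t = t' ->
    u = u' -> [:: x; y; z; t; u] = [:: x'; y'; z'; t'; u'] by move=> -> -> -> -> ->.
split; last split; apply: seq5; rewrite !orientE.
all: by ring.
Qed.

Definition tri_parity a b c d e f : bool :=
  cross a b c d e (+) (cross a b c e f (+) cross a b c d f).

Lemma galeN a b c d e f v w : gale a b c d e f v w = - gale a b c d e f w v.
Proof. rewrite /gale /=; ring. Qed.

Lemma gale_plucker a b c d e f (s x y z : nat) (g := gale a b c d e f) :
  g s x * g y z - g s y * g x z + g s z * g x y = 0.
Proof. rewrite /g /gale /=; ring. Qed.

(* Two triangles in general position intersect in a segment or not at all; the
   endpoints of the segment are the crossings counted on both sides. *)
Lemma tri_parityC a b c d e f :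
  (forall (v w : 'I_6), v != w -> gale a b c d e f v w != 0) ->
  tri_parity a b c d e f = tri_parity d e f a b c.
Proof.
move=> gn0.
have k0 : orient a b c d != 0.
  (* The entry at 4, 5 is the square of [orient a b c d]. *)
  have := gn0 (@Ordinal 6 4 isT) (@Ordinal 6 5 isT) isT.
  by apply: contra_neq => k0; rewrite /gale /= k0; ring.
have kN0 : - orient a b c d != 0 by rewrite oppr_eq0.
pose D (v w : 'I_6) := gale a b c d e f v w.
have := @even_source_sink R 'I_6 D (fun v w => galeN _ _ _ _ _ _ _ _) gn0
  (fun s x y z => gale_plucker _ _ _ _ _ _ _ _ _ _).
have [e0 e1 e2 [e3 e4 e5]] := galeE a b c d e f.
have E v (l : seq 'I_6) (k : R) x y z t u : k != 0 -> (forall w, (w != v) = (w \in l)) ->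
   [seq gale a b c d e f v w | w <- [seq val w | w <- l]] = [seq k * x | x <- radon x y z t u] ->
   source D v (+) sink D v = cross x y z t u.
  move=> kn0 lP h; apply: (source_sink_cross kn0 lP); rewrite -h -map_comp //.
pose O0 := @Ordinal 6 0 isT; pose O1 := @Ordinal 6 1 isT; pose O2 := @Ordinal 6 2 isT.
pose O3 := @Ordinal 6 3 isT; pose O4 := @Ordinal 6 4 isT; pose O5 := @Ordinal 6 5 isT.
have memP v (l : seq 'I_6) : all (fun w => (w != v) == (w \in l)) [:: O0; O1; O2; O3; O4; O5] ->
    forall w : 'I_6, (w != v) = (w \in l).
  move=> /allP h; suff hh w : w \in [:: O0; O1; O2; O3; O4; O5]
    by move=> w; exact: (eqP (h w (hh w))).
  by case: w => [[|[|[|[|[|[|//]]]]]] i]; rewrite (bool_irrelevance i isT) !inE.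
have E0 : source D O0 (+) sink D O0 = cross d e f b c.
  by apply: (@E O0 [:: O3; O4; O5; O1; O2] _ _ _ _ _ _ kN0 _ e0); apply: memP.
have E1 : source D O1 (+) sink D O1 = cross d e f a c.
  by apply: (@E O1 [:: O3; O4; O5; O0; O2] _ _ _ _ _ _ k0 _ e1); apply: memP.
have E2 : source D O2 (+) sink D O2 = cross d e f a b.
  by apply: (@E O2 [:: O3; O4; O5; O0; O1] _ _ _ _ _ _ kN0 _ e2); apply: memP.
have E3 : source D O3 (+) sink D O3 = cross a b c e f.
  by apply: (@E O3 [:: O0; O1; O2; O4; O5] _ _ _ _ _ _ k0 _ e3); apply: memP.
have E4 : source D O4 (+) sink D O4 = cross a b c d f.
  by apply: (@E O4 [:: O0; O1; O2; O3; O5] _ _ _ _ _ _ kN0 _ e4); apply: memP.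
have E5 : source D O5 (+) sink D O5 = cross a b c d e.
  by apply: (@E O5 [:: O0; O1; O2; O3; O4] _ _ _ _ _ _ k0 _ e5); apply: memP.
have -> : \big[addb/false]_v (source D v (+) sink D v) =
  \big[addb/false]_(v <- [:: O0; O1; O2; O3; O4; O5]) (source D v (+) sink D v).
  rewrite !big_cons big_nil !big_ord_recl big_ord0.
  by congr (_ (+) (_ (+) (_ (+) (_ (+) (_ (+) (_ (+) _))))));
    congr (source D _ (+) sink D _); apply: val_inj.
rewrite !big_cons big_nil E0 E1 E2 E3 E4 E5.
rewrite /tri_parity.
move: (cross d e f b c) (cross d e f a c) (cross d e f a b).
move: (cross a b c e f) (cross a b c d f) (cross a b c d e).
by do 6 case.
Qed.
End Orient.

(** By Cramer's rule the entries of [radon] satisfy [l1 *: a + l2 *: b + l3 *: c = l4 *: d + l5 *: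
    e] with equal sums of coefficients on both sides. If all have one sign, division by that sum
    yields a common point. *)
Lemma cross_hulls (R : realFieldType) (a b c d e : 'rV[R]_3) : cross a b c d e ->
  exists r s t u v : R, [/\ [/\ 0 <= r, 0 <= s & 0 <= t], 0 <= u /\ 0 <= v, r + s + t = 1, u + v = 1 &
    r *: a + s *: b + t *: c = u *: d + v *: e].
Proof.
rewrite /cross /radon.
set l1 := orient b c d e; set l2 := - orient a c d e; set l3 := orient a b d e.
set l4 := orient a b c e; set l5 := - orient a b c d.
have hs : l1 + l2 + l3 = l4 + l5.
  by rewrite /l1 /l2 /l3 /l4 /l5 !orientE; ring.
have hv : l1 *: a + l2 *: b + l3 *: c = l4 *: d + l5 *: e.
  apply/rowP => i; rewrite !mxE /l1 /l2 /l3 /l4 /l5 !orientE.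
  case: i => [[|[|[|//]]] hi].
  - by rewrite (_ : Ordinal hi = cx); [ring|apply: val_inj].
  - by rewrite (_ : Ordinal hi = cy); [ring|apply: val_inj].
  - by rewrite (_ : Ordinal hi = cz); [ring|apply: val_inj].
move: l1 l2 l3 l4 l5 hs hv => l1 l2 l3 l4 l5 hs hv.
have main m1 m2 m3 m4 m5 : m1 + m2 + m3 = m4 + m5 ->
    m1 *: a + m2 *: b + m3 *: c = m4 *: d + m5 *: e ->
    all (fun x => 0 < x) [:: m1; m2; m3; m4; m5] ->
  exists r s t u v : R, [/\ [/\ 0 <= r, 0 <= s & 0 <= t], 0 <= u /\ 0 <= v, r + s + t = 1, u + v = 1 &
    r *: a + s *: b + t *: c = u *: d + v *: e].
  move: {l1 l2 l3 l4 l5 hs hv} m1 m2 m3 m4 m5 => l1 l2 l3 l4 l5 hs hv.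
  case/and5P=> p1 p2 p3 p4 /andP [p5 _].
  pose s := l4 + l5; have s0 : 0 < s by rewrite addr_gt0.
  exists (l1 / s), (l2 / s), (l3 / s), (l4 / s), (l5 / s); split.
  - by split; rewrite divr_ge0 ?ltW.
  - by split; rewrite divr_ge0 ?ltW.
  - by rewrite -!mulrDl hs divff ?gt_eqF.
  - by rewrite -mulrDl divff ?gt_eqF.
  - by rewrite ![_ / s]mulrC -!scalerA -!scalerDr hv.
case hp : (all (fun x => 0 < x) _) => /= hn; first exact: main hp.
apply: (main (- l1) (- l2) (- l3) (- l4) (- l5)).
- by rewrite -!opprD hs.
- by rewrite !scaleNr -!opprD hv.
- by rewrite /= !oppr_gt0.
Qed.

(** * Crossing numbers of chains modulo 2 *)

Section Chains.
Variable R : realFieldType.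

Definition general_position (J : finType) (p : J -> 'rV[R]_3) :=
  forall i j k l, uniq [:: i; j; k; l] -> orient (p i) (p j) (p k) (p l) != 0.

Definition boundary_sum (J : Type) (phi : J -> J -> bool) (T : J * J * J) : bool :=
  phi T.1.1 T.1.2 (+) (phi T.1.2 T.2 (+) phi T.1.1 T.2).

(* The boundary of F is C modulo 2, tested against all symmetric functions on edges. *)
Definition bounds (J : Type) (F : seq (J * J * J)) (C : seq (J * J)) : Prop :=
  forall phi : J -> J -> bool, (forall x y, phi x y = phi y x) ->
    \big[addb/false]_(T <- F) boundary_sum phi T = \big[addb/false]_(e <- C) phi e.1 e.2.

Definition icross (J : Type) (p : J -> 'rV[R]_3) (T : J * J * J) (x y : J) : bool :=
  cross (p T.1.1) (p T.1.2) (p T.2) (p x) (p y).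

(** All boundary edges of the triangles of [F'] are kept, even those that cancel, so that symmetry
    can be checked for each pair of triangles. If [F'] bounds a polygon, this is its linking number
    modulo 2 with the boundary of [F]. *)
Definition crossings (J : Type) (p : J -> 'rV[R]_3) (F F' : seq (J * J * J)) : bool :=
  \big[addb/false]_(T <- F) \big[addb/false]_(T' <- F') boundary_sum (icross p T) T'.

Definition verts (J : Type) (T : J * J * J) : seq J := [:: T.1.1; T.1.2; T.2].

Lemma crossings_bounds (J : Type) (p : J -> 'rV[R]_3) F F' C' : bounds F' C' ->
  crossings p F F' = \big[addb/false]_(T <- F) \big[addb/false]_(e <- C') icross p T e.1 e.2.
Proof. by move=> h; apply: eq_bigr => T _; apply: h => x y; apply: crossC. Qed.

Lemma crossings_catl (J : Type) (p : J -> 'rV[R]_3) F1 F2 F' :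
  crossings p (F1 ++ F2) F' = crossings p F1 F' (+) crossings p F2 F'.
Proof. by rewrite /crossings big_cat. Qed.

Lemma crossings_catr (J : Type) (p : J -> 'rV[R]_3) F F1 F2 :
  crossings p F (F1 ++ F2) = crossings p F F1 (+) crossings p F F2.
Proof. by rewrite /crossings -big_split; apply: eq_bigr => T _; rewrite big_cat. Qed.

(** By [galeE] every entry of the Gale diagram off the diagonal is, up to sign, a product of two
    orientations of distinct points, so general position gives the hypothesis of [tri_parityC]. *)
Lemma boundary_sum_icrossC (J : finType) (p : J -> 'rV[R]_3) T T' :
  general_position p -> uniq (verts T ++ verts T') ->
  boundary_sum (icross p T) T' = boundary_sum (icross p T') T.
Proof.
move: T T' => [[a b] c] [[d e] f] gpp /= u; apply: tri_parityC.
have [e0 e1 e2 [e3 e4 e5]] := galeE (p a) (p b) (p c) (p d) (p e) (p f).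
have rn0 x y z t w : uniq [:: x; y; z; t; w] ->
    all (fun r => r != 0) (radon (p x) (p y) (p z) (p t) (p w)).
  rewrite /= !inE !negb_or => /and5P [/and4P [xy xz xt xw] /and3P [yz yt yw] /andP [zt zw] tw _].
  by rewrite !oppr_eq0 !gpp //= !inE !negb_or ?xy ?xz ?xt ?xw ?yz ?yt ?yw ?zt ?zw ?tw.
move: u; rewrite !inE !negb_or => /and5P [/and5P [ab ac ad ae af] /and4P [bc bd be bf]
  /and3P [cd ce cf] /andP [de df] /andP [ef _]].
have k0 : orient (p a) (p b) (p c) (p d) != 0.
  by apply: gpp; rewrite /= !inE !negb_or ab ac ad bc bd cd.
have kN0 : - orient (p a) (p b) (p c) (p d) != 0 by rewrite oppr_eq0.
have grid_node x y z t w (k : R) : k != 0 -> uniq [:: x; y; z; t; w] ->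
    all (fun r => r != 0) [seq k * r | r <- radon (p x) (p y) (p z) (p t) (p w)].
  move=> kn /rn0 /allP h; rewrite all_map; apply/allP => r /h /= rn.
  by rewrite mulf_neq0.
have nz v (l : seq nat) w : all (fun r => r != 0) [seq gale (p a) (p b) (p c) (p d) (p e) (p f) v w | w <- l] ->
   w \in l -> gale (p a) (p b) (p c) (p d) (p e) (p f) v w != 0.
  by rewrite all_map => /allP h /h.
have da : d != a by rewrite eq_sym.
have ea : e != a by rewrite eq_sym.
have fa : f != a by rewrite eq_sym.
have db : d != b by rewrite eq_sym.
have eb : e != b by rewrite eq_sym.
have fb : f != b by rewrite eq_sym.
have dc : d != c by rewrite eq_sym.
have ec : e != c by rewrite eq_sym.
have fc : f != c by rewrite eq_sym.
have u0 : uniq [:: d; e; f; b; c] by rewrite /= !inE !negb_or de df db dc ef eb ec fb fc bc.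
have u1 : uniq [:: d; e; f; a; c] by rewrite /= !inE !negb_or de df da dc ef ea ec fa fc ac.
have u2 : uniq [:: d; e; f; a; b] by rewrite /= !inE !negb_or de df da db ef ea eb fa fb ab.
have u3 : uniq [:: a; b; c; e; f] by rewrite /= !inE !negb_or ab ac ae af bc be bf ce cf ef.
have u4 : uniq [:: a; b; c; d; f] by rewrite /= !inE !negb_or ab ac ad af bc bd bf cd cf df.
have u5 : uniq [:: a; b; c; d; e] by rewrite /= !inE !negb_or ab ac ad ae bc bd be cd ce de.
move: (grid_node _ _ _ _ _ _ kN0 u0) (grid_node _ _ _ _ _ _ k0 u1) (grid_node _ _ _ _ _ _ kN0 u2).
move: (grid_node _ _ _ _ _ _ k0 u3) (grid_node _ _ _ _ _ _ kN0 u4) (grid_node _ _ _ _ _ _ k0 u5).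
rewrite -e0 -e1 -e2 -e3 -e4 -e5 => n5 n4 n3 n2 n1 n0.
case=> [[|[|[|[|[|[|//]]]]]] hv] [w hw] vw; first [apply: (nz _ _ _ n0)|apply: (nz _ _ _ n1)
  |apply: (nz _ _ _ n2)|apply: (nz _ _ _ n3)|apply: (nz _ _ _ n4)|apply: (nz _ _ _ n5)];
  by move: w hw vw; do 6?case=> //.
Qed.

Lemma crossingsC (J : finType) (p : J -> 'rV[R]_3) F F' : general_position p ->
  (forall T T', T \in F -> T' \in F' -> uniq (verts T ++ verts T')) ->
  crossings p F F' = crossings p F' F.
Proof.
move=> gpp u; rewrite /crossings exchange_big; apply: eq_big_seq => T' hT'.
by apply: eq_big_seq => T hT; apply: boundary_sum_icrossC => //; apply: u.
Qed.

Lemma bounds_map (J J' : Type) (g : J -> J') F C : bounds F C ->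
  bounds [seq (g T.1.1, g T.1.2, g T.2) | T <- F] [seq (g e.1, g e.2) | e <- C].
Proof.
move=> h phi sphi; rewrite !big_map.
by apply: (h (fun x y => phi (g x) (g y))) => x y; apply: sphi.
Qed.
End Chains.

(** * Perturbation to general position *)

Section Perturb.
Variable R : realType.
Implicit Types n v t : 'rV[R]_3.

Lemma ord3P (P : 'I_3 -> Prop) : P cx -> P cy -> P cz -> forall i, P i.
Proof. by move=> ? ? ?; case=> [[|[|[|//]]]] i; rewrite (bool_irrelevance i isT). Qed.

Lemma norm_rV_lt m (v : 'rV[R]_m) (e : R) : 0 < e -> (forall i, `|v ord0 i| < e) -> `|v| < e.
Proof.
move=> e0 h; rewrite [ltLHS]/Num.Def.normr/= mx_normrE bigmax_lt //= => -[i j] _.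
by rewrite (ord1 i).
Qed.

Definition dot n v : R := n 0 cx * v 0 cx + n 0 cy * v 0 cy + n 0 cz * v 0 cz.

Definition vec3 (x y z : R) : 'rV[R]_3 := \row_(i < 3) [:: x; y; z]`_i.

(* On the curve t + (s, s^2, s^3) each equation is a nonzero polynomial in s. *)
Lemma avoid_planes (l : seq ('rV[R]_3 * R)) t (e : R) : 0 < e ->
  (forall h, h \in l -> h.1 != 0) ->
  exists2 v, `|v - t| < e & forall h, h \in l -> dot h.1 v != h.2.
Proof.
move=> e0 hl.
pose P (h : 'rV[R]_3 * R) : {poly R} :=
  Poly [:: dot h.1 t - h.2; h.1 0 cx; h.1 0 cy; h.1 0 cz].
have Pn0 h : h \in l -> P h != 0.
  move=> /hl; apply: contra_neq => /polyP Ph; apply/rowP; apply: ord3P; rewrite mxE.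
  - by have := Ph 1%N; rewrite coef_Poly coef0.
  - by have := Ph 2%N; rewrite coef_Poly coef0.
  - by have := Ph 3%N; rewrite coef_Poly coef0.
pose Q := \prod_(h <- l) P h.
have Qn0 : Q != 0 by rewrite prodf_seq_neq0; apply/allP => h /Pn0.
pose d := Num.min 1 (e / 2).
have d0 : 0 < d by rewrite lt_min ltr01 divr_gt0.
pose s (k : nat) : R := d / k.+1%:R.
have s0 k : 0 < s k by rewrite divr_gt0.
have sd k : s k <= d by rewrite ler_pdivrMr // ler_peMr ?ler1n // ltW.
have sinj : injective s.
  move=> i j /(mulfI (lt0r_neq0 d0)) /invr_inj /eqP; rewrite eqr_nat => /eqP.
  by case.
have [k hk] : exists k, ~~ root Q (s k).
  apply: contrapT => /forallNP h.
  have := @max_poly_roots _ Q (map s (iota 0 (size Q))) Qn0.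
  rewrite size_map size_iota ltnn map_inj_uniq // iota_uniq => H.
  suff : false by []; apply: H => //; apply/allP => _ /mapP [k _ ->].
  by apply/negPn/negP; apply: h.
exists (t + vec3 (s k) (s k ^+ 2) (s k ^+ 3)).
  rewrite addrC addKr; apply: norm_rV_lt => // i.
  have s1 : s k <= 1 by apply: (le_trans (sd k)); rewrite ge_min lexx.
  have se : s k < e.
    by apply: (le_lt_trans (sd k)); rewrite gt_min; apply/orP; right; lra.
  have h m : `|s k ^+ m.+1| < e.
    rewrite ger0_norm ?exprn_ge0 ?ltW //; apply: le_lt_trans se.
    by rewrite exprS; apply: ler_piMr; [exact: ltW|apply: exprn_ile1 => //; exact: ltW].
  by move: i; apply: ord3P; rewrite mxE /=; [exact: (h 0%N)|exact: (h 1%N)|exact: (h 2%N)].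
move=> h hl'; apply: contra hk => /eqP hh.
rewrite /root horner_prod prodf_seq_eq0; apply/hasP; exists h => //.
rewrite /P horner_Poly /=; apply/eqP; move: hh; rewrite /dot !mxE /= => hh.
rewrite -hh; ring.
Qed.

Definition normal3 (a b c : 'rV[R]_3) : 'rV[R]_3 :=
  let u := b - a in let v := c - a in
  vec3 (u 0 cy * v 0 cz - u 0 cz * v 0 cy) (u 0 cz * v 0 cx - u 0 cx * v 0 cz)
      (u 0 cx * v 0 cy - u 0 cy * v 0 cx).

Lemma orient_dot (a b c d : 'rV[R]_3) :
  orient a b c d = dot (normal3 a b c) d - dot (normal3 a b c) a.
Proof. rewrite orientE /dot /normal3 !mxE /=; ring. Qed.

Definition general_position_on (J : eqType) (s : seq J) (p : J -> 'rV[R]_3) :=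
  forall i j k l, i \in s -> j \in s -> k \in s -> l \in s -> uniq [:: i; j; k; l] ->
    orient (p i) (p j) (p k) (p l) != 0.

(** The new point has to avoid the planes spanned by triples from [s]. Such a plane has a nonzero
    normal because a fourth point of [s] lies off it; this is the origin of the bound [3 < size s]
    and of its analogues below. *)
Lemma general_position_on_cons (J : eqType) (s : seq J) (p : J -> 'rV[R]_3) x e :
  0 < e -> (3 < size s)%N -> uniq s -> x \notin s -> general_position_on s p ->
  exists2 v, `|v - p x| < e & general_position_on (x :: s) (fun y => if y == x then v else p y).
Proof.
move=> e0 s4 us xs gs.
pose N (i j k : J) := (normal3 (p i) (p j) (p k), dot (normal3 (p i) (p j) (p k)) (p i)).
pose l := [seq N ij.1 ij.2 k | ij <- [seq (i, j) | i <- s, j <- s], k <- [seq k <- s | uniq [:: ij.1; ij.2; k]]].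
have lP h : h \in l -> exists i j k, [/\ i \in s, j \in s, k \in s, uniq [:: i; j; k] & h = N i j k].
  move=> /allpairsPdep [[i j] [k [/allpairsP [[i' j'] [/= hi hj [-> ->]]]]]].
  by rewrite mem_filter => /andP [u hk] ->; exists i', j', k.
have [|v vp hv] := @avoid_planes l (p x) e e0 _.
  move=> h /lP [i [j [k [hi hj hk u ->]]]] /=.
  have /allPn [m hm] : ~~ all (mem [:: i; j; k]) s.
    apply/negP => /allP hs; have := uniq_leq_size us hs; rewrite /=.
    by rewrite leqNgt s4.
  move=> mijk.
  have um : uniq (rcons [:: i; j; k] m) by rewrite rcons_uniq; apply/andP; split.
  have := gs i j k m hi hj hk hm um.
  by rewrite orient_dot; apply: contra_neq => ->; rewrite /dot !mxE; ring.
exists v => //.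
have key i j k : i \in s -> j \in s -> k \in s -> uniq [:: i; j; k] -> orient (p i) (p j) (p k) v != 0.
  move=> hi hj hk u; rewrite orient_dot subr_eq0.
  apply: (hv (N i j k)); apply/allpairsPdep; exists (i, j), k; split => //=.
    by apply/allpairsP; exists (i, j).
  by rewrite mem_filter hk andbT; exact: u.
have nx i : i \in s -> (i == x) = false by apply: contraTF => /eqP ->.
have sw1 (a b c d : 'rV[R]_3) : orient a b d c = - orient a b c d by rewrite !orientE; ring.
have sw2 (a b c d : 'rV[R]_3) : orient a d b c = orient a b c d by rewrite !orientE; ring.
have sw3 (a b c d : 'rV[R]_3) : orient d a b c = - orient a b c d by rewrite !orientE; ring.
move=> i j k m; rewrite !inE.
have [->|ix] := eqVneq i x; have [->|jx] := eqVneq j x; have [->|kx] := eqVneq k x;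
  have [->|mx] := eqVneq m x; rewrite /= ?inE ?eqxx ?orbT ?andbF //= => hi hj hk hm u.
- rewrite sw3 oppr_eq0 key //; move: u; rewrite /= !inE !negb_or !andbT -!andbA;
  do ?[case/andP=> ?]; move=> ?; do ?[apply/andP; split=> //].
- rewrite sw2 key //; move: u; rewrite /= !inE !negb_or !andbT -!andbA;
  do ?[case/andP=> ?]; move=> ?; do ?[apply/andP; split=> //].
- rewrite sw1 oppr_eq0 key //; move: u; rewrite /= !inE !negb_or !andbT -!andbA;
  do ?[case/andP=> ?]; move=> ?; do ?[apply/andP; split=> //].
- rewrite key //; move: u; rewrite /= !inE !negb_or !andbT -!andbA;
  do ?[case/andP=> ?]; move=> ?; do ?[apply/andP; split=> //].
- by apply: gs => //; move: u; rewrite /= !inE !negb_or.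
Qed.

Lemma general_position_on_cat (J : eqType) (s s' : seq J) (p : J -> 'rV[R]_3) e :
  0 < e -> (3 < size s)%N -> uniq (s' ++ s) -> general_position_on s p ->
  exists p', [/\ {in s, p' =1 p}, forall x, `|p' x - p x| < e & general_position_on (s' ++ s) p'].
Proof.
move=> e0 s4; elim: s' => [|x s' IH] /= => [us gs|/andP [xs us] gs].
  by exists p; split => // x; rewrite subrr normr0.
have [p' [ps pe gp']] := IH us gs.
have [||v vp gv] := @general_position_on_cons _ (s' ++ s) p' x (e - `|p' x - p x|) _ _ us xs gp'.
- by rewrite subr_gt0.
- by rewrite size_cat ltn_addl.
exists (fun y => if y == x then v else p' y); split => // [y ys|y].
  by case: eqP => [yx|_]; [move: xs; rewrite mem_cat -yx ys orbT|exact: ps].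
case: eqP => [->|_ //].
rewrite -[v](subrK (p' x)) -addrA; apply: le_lt_trans (ler_normD _ _) _.
by rewrite -ltrBrDr.
Qed.

(** The fixed points may not move at all: they will be a polygon whose crossings are being counted,
    or the reference points on the moment curve. *)
Lemma general_position_extend (J : finType) (fixed : pred J) (p : J -> 'rV[R]_3) e :
  0 < e -> (3 < #|fixed|)%N -> general_position_on (enum fixed) p ->
  exists p', [/\ forall x, fixed x -> p' x = p x, forall x, `|p' x - p x| < e & general_position p'].
Proof.
move=> e0 f4 gs.
have [||p' [h1 h2 h3]] := @general_position_on_cat _ (enum fixed) (enum (predC fixed)) p e e0 _ _ gs.
- by rewrite -cardE.
- rewrite cat_uniq !enum_uniq /= andbT; apply/hasPn => x; rewrite !mem_enum !inE => fx.
  by rewrite negbK.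
exists p'; split => // [x fx|i j k l]; first by apply: h1; rewrite mem_enum.
have all_in x : x \in enum (predC fixed) ++ enum fixed.
  by rewrite mem_cat !mem_enum inE /= orbC orbN.
exact: h3.
Qed.
End Perturb.

Local Open Scope classical_set_scope.

(** * Continuity and compactness *)

Section ContOn.
Variable R : realType.
Implicit Types V W : pseudoMetricNormedZmodType R.

Definition cont_on V W (A : set V) (f : V -> W) := forall x, A x ->
  forall e, 0 < e -> exists2 d, 0 < d & forall y, A y -> `|x - y| < d -> `|f x - f y| < e.

Lemma cont_onP V W (A : set V) (f : V -> W) :
  {within A, continuous f} <-> cont_on A f.
Proof.
split=> [/subspace_continuousP h x Ax e e0|h].
  have /cvgrPdist_lt /(_ e e0) := h x Ax.
  rewrite near_withinE => /nbhs_normP [d /= d0 hd].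
  by exists d => // y Ay xy; apply: hd.
apply/subspace_continuousP => x Ax; apply/cvgrPdist_lt => e e0.
have [d d0 hd] := h x Ax e e0.
rewrite near_withinE; apply/nbhs_normP; exists d => // y /= xy Ay.
exact: hd.
Qed.

Lemma cont_on_unif V W (A : set V) (f : V -> W) : compact A -> cont_on A f ->
  forall e, 0 < e -> exists2 d, 0 < d & forall x y, A x -> A y -> `|x - y| < d -> `|f x - f y| < e.
Proof.
move=> /compact_near_coveringP cA cf e e0.
have := cA R (0^'+) (fun d x => A x -> forall y, A y -> `|x - y| < d -> `|f x - f y| < e) _.
case=> [x Ax|d /= d0 hd].
  have e2 : 0 < e / 2 by rewrite divr_gt0.
  have [d d0 hd] := cf x Ax _ e2.
  have d2 : 0 < d / 2 by rewrite divr_gt0.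
  exists (ball x (d / 2), [set t | t < d / 2]) => /=.
    by split; [exact: nbhsx_ballx|exact: nbhs_right_lt].
  move=> [x' t] /= []; rewrite -ball_normE /= => xx' td Ax' y Ay x'y.
  rewrite -[f x'](subrK (f x)) -addrA (le_lt_trans (ler_normD _ _)) //.
  rewrite [e]splitr ltrD //.
    by rewrite distrC hd // (lt_trans xx') // [ltRHS]splitr ltrDl.
  apply: hd => //; rewrite -[x](subrK x') -addrA (le_lt_trans (ler_normD _ _)) //.
  by rewrite [d]splitr ltrD // (lt_trans x'y).
exists (d / 2); first by rewrite divr_gt0.
move=> x y Ax Ay xy; apply: (hd (d / 2)) => //=; last by rewrite divr_gt0.
by rewrite sub0r normrN gtr0_norm ?divr_gt0 // [ltRHS]splitr ltrDl divr_gt0.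
Qed.

Lemma compact_closed_dist V (A B : set V) : compact A -> closed B -> A `&` B = set0 ->
  exists2 d, 0 < d & forall x y, A x -> B y -> d <= `|x - y|.
Proof.
move=> /compact_near_coveringP cA cB AB.
have := cA R (0^'+) (fun d x => forall y, B y -> d <= `|x - y|) _.
case=> [x Ax|d /= d0 hd].
  have : nbhs x (~` B).
    apply: open_nbhs_nbhs; split; first exact: closed_openC.
    by move=> Bx; rewrite -[False]/(set0 x) -AB.
  move=> /nbhs_normP [d /= d0 hd].
  have d2 : 0 < d / 2 by rewrite divr_gt0.
  exists (ball x (d / 2), [set t | t < d / 2]) => /=.
    by split; [exact: nbhsx_ballx|exact: nbhs_right_lt].
  move=> [x' t] /= []; rewrite -ball_normE /= => xx' td y By.
  rewrite leNgt; apply/negP => x'y; apply: (hd y) => //=.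
  rewrite -[x](subrK x') -addrA (le_lt_trans (ler_normD _ _)) //.
  by rewrite [d]splitr ltrD // (lt_trans x'y).
exists (d / 2); first by rewrite divr_gt0.
move=> x y Ax By; apply: (hd (d / 2)) => //=; last by rewrite divr_gt0.
by rewrite sub0r normrN gtr0_norm ?divr_gt0 // [ltRHS]splitr ltrDl divr_gt0.
Qed.

End ContOn.

(** * Pushing a cone off the second component *)

Section NullGrid.
Variables (R : realType) (E : normedModType R).

(* r is the identity on W, the side of S that contains K1, and outside W it applies
   the contraction Phi of S at the time d(u, S) / eps. *)
Lemma push_into (K1 K2 W S A C : set E) (Phi : E -> R -> E) (z0 : E) (eta r2 : R) :
  compact K2 -> closed S -> K1 `<=` W ->
  (forall x, K2 x -> ~ W x /\ ~ S x) ->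
  (forall x y, W x -> ~ W y -> exists2 t, 0 <= t <= 1 & S (x + t *: (y - x))) ->
  0 < eta -> (forall u x, A u -> S x -> `|u - x| < eta -> C x) ->
  (forall e, 0 < e -> exists2 d, 0 < d & forall x y s t, C x -> C y -> 0 <= s <= 1 ->
     0 <= t <= 1 -> `|x - y| < d -> `|s - t| < d -> `|Phi x s - Phi y t| < e) ->
  (forall x, C x -> Phi x 0 = x /\ Phi x 1 = z0) ->
  0 < r2 ->
  (forall k x t, K2 k -> C x -> 0 <= t <= 1 -> r2 <= `|k - Phi x t|) ->
  (forall k, K2 k -> r2 <= `|k - z0|) ->
  exists (r : E -> E) (rho delta : R), [/\ 0 < rho, 0 < delta,
    forall x, K1 x -> r x = x,
    forall u k, K2 k -> 5 * rho <= `|k - r u| &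
    forall u v, A u -> A v -> `|u - v| < delta -> `|r u - r v| < rho].
Proof.
move=> cK2 cS K1W K2P sep eta0 CP uPhi PhiP r20 hr2 hz0.
(* A point of [K2] in the closure of [W] would be joined to [W] by arbitrarily short segments; these
   meet [S], whereas [S] is closed and misses [K2]. *)
have [r1 r10 hr1] : exists2 d, 0 < d & forall k w, K2 k -> W w -> d <= `|k - w|.
  have [||d d0 hd] := @compact_closed_dist R E K2 (closure W) cK2; first exact: closed_closure.
    rewrite -subset0 => k [kK2 kW].
    have [nW nS] := K2P k kK2.
    have : nbhs k (~` S) by apply: open_nbhs_nbhs; split => //; exact: closed_openC.
    move=> /nbhs_normP [d /= d0 hd].
    have [w [Ww kw]] := kW _ (nbhsx_ballx k d d0).
    have [t /andP [t0 t1] St] := sep _ _ Ww nW.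
    move: kw; rewrite -ball_normE /= => kw.
    apply: (hd _ _ St) => /=.
    have -> : k - (w + t *: (k - w)) = (1 - t) *: (k - w).
      by rewrite scalerBl scale1r opprD addrA.
    rewrite normrZ ger0_norm ?subr_ge0 //; apply: le_lt_trans kw.
    by rewrite ler_piMl // gerBl.
  by exists d => // k w Kk Ww; apply: hd => //; apply: subset_closure.
(* The factor 5 serves [unlinked], where a crossing would bring a point of [K2] within [4 * rho] of
   a value of [r]. *)
pose rho := Num.min r1 r2 / 5.
have rho0 : 0 < rho by rewrite divr_gt0 // lt_min r10.
have rho1 : 5 * rho <= r1.
  by rewrite /rho mulrC divfK ?pnatr_eq0 // ge_min lexx.
have rho2 : 5 * rho <= r2.
  by rewrite /rho mulrC divfK ?pnatr_eq0 // ge_min lexx orbT.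
have rho4 : 0 < rho / 4 by rewrite divr_gt0.
have [e1 e10 he1] := uPhi (rho / 4) rho4.
(* [eps] is the width of the collar of [C] in which the time [d u / eps] of the contraction runs
   from 0 to 1. The bound [delta <= eps * e1] makes this time change by less than [e1] in one
   step. *)
pose eps := Num.min e1 rho / 8.
have eps0 : 0 < eps by rewrite divr_gt0 // lt_min e10.
have eps1 : 8 * eps <= e1.
  by rewrite /eps mulrC divfK ?pnatr_eq0 // ge_min lexx.
have eps2 : 8 * eps <= rho.
  by rewrite /eps mulrC divfK ?pnatr_eq0 // ge_min lexx orbT.
pose delta := Num.min (Num.min eps (eps * e1)) eta.
have delta0 : 0 < delta by rewrite !lt_min eps0 eta0 mulr_gt0.
have delta1 : delta <= eps by rewrite /delta !ge_min lexx.
have delta2 : delta <= eps * e1 by rewrite /delta !ge_min lexx orbT.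
have delta3 : delta <= eta by rewrite /delta !ge_min lexx orbT.
(* For empty [C] this infimum is a default value, so each bound on [d] below assumes a point of
   [C]. *)
pose d u := inf [set `|u - c| | c in C].
have dlb u : lbound [set `|u - c| | c in C] 0 by move=> _ [c _ <-].
have dle u c : C c -> d u <= `|u - c|.
  by move=> Cc; apply: ge_inf; [exists 0; exact: dlb|exists c].
have dge u x c0 : C c0 -> (forall c, C c -> x <= `|u - c|) -> x <= d u.
  move=> Cc0 h; apply: lb_le_inf; first by exists `|u - c0|, c0.
  by move=> _ [c Cc <-]; exact: h.
have d0 u c : C c -> 0 <= d u by move=> Cc; apply: (dge _ _ c Cc).
have dL u v c : C c -> d u - `|u - v| <= d v.
  move=> Cc; apply: (dge _ _ c Cc) => c' Cc'; rewrite lerBlDl.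
  apply: (le_trans (dle u _ Cc')); rewrite -[u in u - c'](subrK v) -addrA.
  exact: ler_normD.
pose nearC u := exists2 c, C c & `|u - c| < eps.
(* Any choice within [eps] will do: for points [delta]-close to each other the choices differ by
   less than [3 * eps], which is below [e1]. *)
have [pr prP] : {pr : E -> E & forall u, nearC u -> C (pr u) /\ `|u - pr u| < eps}.
  apply: (@choice _ _ (fun u c => nearC u -> C c /\ `|u - c| < eps)) => u.
  have [[c Cc uc]|h] := pselect (nearC u); first by exists c.
  by exists u => /h.
pose r u := if `[< W u >] then u else if `[< nearC u >] then Phi (pr u) (d u / eps) else z0.
have tau u : nearC u -> 0 <= d u / eps <= 1.
  move=> [c Cc uc]; apply/andP; split.
    by apply: divr_ge0; [exact: (d0 u c)|exact: ltW].
  by rewrite ler_pdivrMr // mul1r; apply: le_trans (ltW uc); exact: dle.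
exists r, rho, delta; split => //.
- by move=> x /K1W Wx; rewrite /r asboolT.
- move=> u k Kk; rewrite /r; case: asboolP => Wu.
    by apply: le_trans rho1 _; apply: hr1.
  case: asboolP => [nu|_]; last by apply: le_trans rho2 _; exact: hz0.
  by apply: le_trans rho2 _; apply: hr2 => //; [exact: (prP _ nu).1|exact: tau].
(* The segment from [u] to [v] meets [S] in a point of [C], so [v] is within [delta] of [C]: its
   time is close to 0, and [r v] is close to [pr v], hence to [u]. *)
have caseW u v : A u -> `|u - v| < delta -> W u -> ~ W v -> `|u - r v| < rho.
  move=> Au uv Wu Wv.
  have [t /andP [t0 t1] St] := sep _ _ Wu Wv.
  set c := u + _ in St.
  have uc : u - c = t *: (u - v) by rewrite /c opprD addrA subrr add0r -scalerN opprB.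
  have vc : v - c = (1 - t) *: (v - u).
    by rewrite /c scalerBl scale1r opprD addrA.
  have Cc : C c.
    apply: (CP u) => //; apply: lt_le_trans delta3; apply: le_lt_trans uv.
    by rewrite uc normrZ ger0_norm // ler_piMl.
  have vcd : `|v - c| < delta.
    apply: le_lt_trans uv; rewrite vc normrZ ger0_norm ?subr_ge0 // distrC.
    by rewrite ler_piMl // gerBl.
  have nv : nearC v by exists c => //; apply: lt_le_trans delta1.
  rewrite /r asboolF // asboolT //.
  have [Cpi vpr] := prP _ nv.
  have [P0 _] := PhiP _ Cpi.
  have dv : d v / eps < e1.
    rewrite ltr_pdivrMr // mulrC; apply: lt_le_trans delta2.
    by apply: le_lt_trans vcd; exact: dle.
  have : `|Phi (pr v) 0 - Phi (pr v) (d v / eps)| < rho / 4.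
    apply: he1 => //; rewrite ?lexx ?ler01 ?subrr ?normr0 //; first exact: tau.
    by rewrite sub0r normrN ger0_norm //; case/andP: (tau _ nv).
  rewrite P0 => h.
  have -> : u - Phi (pr v) (d v / eps) = (u - v) + (v - pr v) + (pr v - Phi (pr v) (d v / eps)).
    by rewrite !addrA !subrK.
  apply: le_lt_trans (ler_normD _ _) _; apply: le_lt_trans (lerD (ler_normD _ _) (lexx _)) _.
  move: uv vpr h delta1 eps2 rho0; lra.
(* Here [u] is just inside the collar: its time is close to 1, where the contraction has reached
   [z0]. *)
have caseN u v : `|u - v| < delta -> ~ W u -> ~ W v -> nearC u -> ~ nearC v -> `|r u - r v| < rho.
  move=> uv Wu Wv nu nv; rewrite /r (asboolF Wu) (asboolF Wv) (asboolT nu) (asboolF nv).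
  have [Cpi upr] := prP _ nu.
  have [_ P1] := PhiP _ Cpi; rewrite -P1.
  apply: lt_le_trans (_ : rho / 4 <= _); last by move: rho0; lra.
  apply: he1 => //; rewrite ?lexx ?ler01 ?subrr ?normr0 //; first exact: tau.
  have dv : eps <= d v.
    apply: (dge _ _ _ Cpi) => c Cc; rewrite leNgt; apply/negP => vc.
    by apply: nv; exists c.
  have := dL v u _ Cpi; rewrite distrC => dvu.
  rewrite distrC ger0_norm ?subr_ge0; last by case/andP: (tau _ nu).
  rewrite ltrBlDr -ltrBlDl ltr_pdivlMr //.
  rewrite mulrBl mul1r [e1 * _]mulrC; move: uv delta2 dv dvu; lra.
move=> u v Au Av uv.
have vu : `|v - u| < delta by rewrite distrC.
have [Wu|Wu] := pselect (W u); have [Wv|Wv] := pselect (W v).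
- by rewrite /r !asboolT //; apply: lt_le_trans uv _; move: delta1 eps2 eps0; lra.
- by rewrite {1}/r asboolT //; exact: caseW.
- by rewrite distrC {1}/r asboolT //; exact: caseW.
have [nu|nu] := pselect (nearC u); have [nv|nv] := pselect (nearC v).
- rewrite /r !(asboolF Wu) !(asboolF Wv) !asboolT //.
  have [Cu upr] := prP _ nu; have [Cv vpr] := prP _ nv.
  apply: lt_le_trans (_ : rho / 4 <= _); last by move: rho0; lra.
  apply: he1 => //; [exact: tau|exact: tau| |].
    have -> : pr u - pr v = - (u - pr u) + (u - v) + (v - pr v).
      by rewrite opprB !addrA !subrK.
    apply: le_lt_trans (ler_normD _ _) _; apply: le_lt_trans (lerD (ler_normD _ _) (lexx _)) _.
    rewrite normrN; move: uv upr vpr delta1 eps1 eps0; lra.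
  rewrite -mulrBl normrM [`|eps^-1|]ger0_norm ?invr_ge0 ?ltW // ltr_pdivrMr // mulrC.
  apply: lt_le_trans delta2; apply: le_lt_trans uv; rewrite ler_norml.
  have := dL u v _ Cu; have := dL v u _ Cu; rewrite distrC => h1 h2.
  apply/andP; split; lra.
- exact: caseN.
- by rewrite distrC; exact: caseN.
- by rewrite /r !(asboolF Wu) !(asboolF Wv) !asboolF // subrr normr0.
Qed.
End NullGrid.

(** * Triangulated contractions *)

Section GridChain.
Variables (J : finType) (M : nat).
Definition grid_node (l : nat) (x : J) : option (J * 'I_M.+1) := Some (x, inord l).
(** [None] is the apex. Every square between levels [l] and [l.+1] over an edge of [C] is cut along
    a diagonal, and the top level [M] is coned off to the apex. *)
Definition grid (C : seq (J * J)) :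
    seq (option (J * 'I_M.+1) * option (J * 'I_M.+1) * option (J * 'I_M.+1)) :=
  [seq (grid_node l e.1, grid_node l e.2, grid_node l.+1 e.2) | e <- C, l <- iota 0 M] ++
  [seq (grid_node l e.1, grid_node l.+1 e.1, grid_node l.+1 e.2) | e <- C, l <- iota 0 M] ++
  [seq (None, grid_node M e.1, grid_node M e.2) | e <- C].

(** The boundary of [C] is zero modulo 2, tested against functions on vertices. *)
Definition cycle_chain (J' : Type) (C : seq (J' * J')) :=
  forall g : J' -> bool, \big[addb/false]_(e <- C) (g e.1 (+) g e.2) = false.

Lemma big_addb_telescope (h : nat -> bool) n :
  \big[addb/false]_(l <- iota 0 n) (h l (+) h l.+1) = h 0%N (+) h n.
Proof.
elim: n => [|n IH]; first by rewrite big_nil addbb.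
rewrite -[in iota _ _]addn1 iotaD big_cat IH /= big_cons big_nil addbF /= add0n.
by rewrite addbA addbK.
Qed.

Lemma grid_bounds (C : seq (J * J)) : cycle_chain C ->
  bounds (grid C) [seq (grid_node 0 e.1, grid_node 0 e.2) | e <- C].
Proof.
move=> cC phi sphi.
rewrite !big_cat /= !big_map !big_allpairs_dep /=.
rewrite -!big_split /=.
(* [g x] collects the edges of the grid that lie over the vertex [x]; as [C] is a cycle, they
   cancel. *)
pose g x := phi None (grid_node M x) (+) \big[addb/false]_(l <- iota 0 M) phi (grid_node l x) (grid_node l.+1 x).
rewrite -[RHS]addbF -[X in _ = _ (+) X](cC g) -big_split; apply: eq_bigr => e _ /=.
rewrite addbA -big_split /=.
under eq_bigr => l _.
  have -> : boundary_sum phi (grid_node l e.1, grid_node l e.2, grid_node l.+1 e.2) (+)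
            boundary_sum phi (grid_node l e.1, grid_node l.+1 e.1, grid_node l.+1 e.2) =
    (phi (grid_node l e.1) (grid_node l e.2) (+) phi (grid_node l.+1 e.1) (grid_node l.+1 e.2)) (+)
    (phi (grid_node l e.1) (grid_node l.+1 e.1) (+) phi (grid_node l e.2) (grid_node l.+1 e.2)).
    rewrite /boundary_sum /=.
    move: (phi (grid_node l e.1) (grid_node l e.2)) (phi (grid_node l e.2) _) (phi (grid_node l e.1) (grid_node l.+1 e.2)).
    move: (phi (grid_node l e.1) (grid_node l.+1 e.1)) (phi (grid_node l.+1 e.1) _).
    by do 5 case.
  over.
rewrite big_split /= (big_addb_telescope (fun l => phi (grid_node l e.1) (grid_node l e.2))) big_split /=.
rewrite /g /boundary_sum /=.
set s1 := \big[_/_]_(l <- _) _; set s2 := \big[_/_]_(l <- _) _.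
move: (phi (grid_node 0 e.1) _) (phi (grid_node M e.1) _) (phi None (grid_node M e.1)) (phi None (grid_node M e.2)) => A B c d.
by case: s1; case: s2; case: A; case: B; case: c; case: d.
Qed.
End GridChain.

Section Unlinked.
Variable R : realType.
Notation E := 'rV[R]_3.

Lemma hull3_near (c p1 p2 p3 : E) (e r s t : R) : 0 <= r -> 0 <= s -> 0 <= t -> r + s + t = 1 ->
  `|p1 - c| < e -> `|p2 - c| < e -> `|p3 - c| < e ->
  `|r *: p1 + s *: p2 + t *: p3 - c| <= e.
Proof.
move=> r0 s0 t0 rst h1 h2 h3.
have -> : r *: p1 + s *: p2 + t *: p3 - c = r *: (p1 - c) + s *: (p2 - c) + t *: (p3 - c).
  rewrite !scalerBr -[c in LHS]scale1r -rst !scalerDl !opprD !addrA.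
  by apply/rowP => i; rewrite !mxE; ring.
apply: le_trans (ler_normD _ _) _; apply: le_trans (lerD (ler_normD _ _) (lexx _)) _.
rewrite !normrZ !ger0_norm // -[e]mul1r -rst !mulrDl.
by rewrite !lerD // ler_wpM2l // ltW.
Qed.

Lemma cross_near (p1 p2 p3 q1 q2 c y : E) (e : R) : cross p1 p2 p3 q1 q2 ->
  `|p1 - c| < e -> `|p2 - c| < e -> `|p3 - c| < e -> `|q1 - y| < e -> `|q2 - y| < e ->
  `|y - c| <= e + e.
Proof.
move=> /cross_hulls [r [s [t [u [v [[r0 s0 t0] [u0 v0] rst uv h]]]]]] h1 h2 h3 h4 h5.
have H1 := hull3_near r0 s0 t0 rst h1 h2 h3.
have uv0 : u + v + 0 = 1 by rewrite addr0.
have := hull3_near u0 v0 (lexx 0) uv0 h4 h5 h5.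
rewrite scale0r addr0 -h distrC => H2.
set z := r *: p1 + _ + _ in H1 H2.
rewrite -[y](subrK z) -addrA; apply: le_trans (ler_normD _ _) _.
exact: lerD.
Qed.

(* Polygons e-close to K1 and K2 have linking number 0; F2 is a disk bounded by the
   polygon of K2. *)
Definition unlinked_at (K1 K2 : set 'rV[R]_3) (e : R) :=
  forall (J : finType) (p k : J -> E) C1 C2 F2,
    general_position p -> (3 < #|J|)%N -> cycle_chain C1 ->
    (forall d, d \in C1 -> [/\ d.1 != d.2, K1 (k d.1), K1 (k d.2), `|k d.1 - k d.2| < e &
        `|p d.1 - k d.1| < e /\ `|p d.2 - k d.2| < e]) ->
    (forall d, d \in C2 -> exists2 y, K2 y & `|p d.1 - y| < e /\ `|p d.2 - y| < e) ->
    bounds F2 C2 ->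
    (forall T d, T \in F2 -> d \in C1 -> uniq (verts T ++ [:: d.1; d.2])) ->
    \big[addb/false]_(T <- F2) \big[addb/false]_(d <- C1) icross p T d.1 d.2 = false.

(** The triangles of [grid M C1], placed by [r] along the cone, stay too close to values of [r] to
    meet the edges of [C2]. The chain is bounded by [C1], so by [crossingsC] its crossings with [C2]
    are as many, modulo 2, as those of [F2] with [C1]. *)
Lemma unlinked (K1 K2 : set E) (a : E) (B : R) (r : E -> E) (rho delta : R) :
  (forall x, K1 x -> `|a - x| <= B) ->
  0 < rho -> 0 < delta ->
  (forall x, K1 x -> r x = x) ->
  (forall u k, K2 k -> 5 * rho <= `|k - r u|) ->
  (forall x y s t, K1 x -> K1 y -> 0 <= s <= 1 -> 0 <= t <= 1 ->
     let u := x + s *: (a - x) in let v := y + t *: (a - y) in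
     `|u - v| < delta -> `|r u - r v| < rho) ->
  exists2 e, 0 < e & unlinked_at K1 K2 e.
Proof.
move=> K1B rho0 delta0 rK1 rK2 rA.
pose e := Num.min rho (delta / 2).
have e0 : 0 < e by rewrite lt_min rho0 divr_gt0.
have e1 : e <= rho by rewrite ge_min lexx.
have e2 : e <= delta / 2 by rewrite ge_min lexx orbT.
exists e => // J p k C1 C2 F2 gpp J3 cC1 C1P C2P bF2 uF2.
(* Levels are spaced by less than [delta / 2], as are the ends of the edges of [C1]; so the
   diagonals of the grid squares span less than [delta]. *)
have [M M0 MB] : exists2 M : nat, (0 < M)%N & B / M%:R < delta / 2.
  pose b := `|B| / (delta / 2).
  exists (Num.bound b).+1 => //.
  have b0 : 0 <= b by rewrite divr_ge0 // ltW // divr_gt0.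
  have h : b < (Num.bound b).+1%:R.
    by apply: lt_le_trans (archi_boundP b0) _; rewrite ler_nat.
  rewrite ltr_pdivrMr ?ltr0n // mulrC; apply: le_lt_trans (ler_norm B) _.
  by move: h; rewrite /b ltr_pdivrMr ?divr_gt0.
pose lv (l : nat) (x : J) : E := k x + (l%:R / M%:R) *: (a - k x).
(* Level 0 has to carry the given polygon itself, whose vertices are only close to [K1]; it stays
   fixed while the rest is moved into general position. *)
pose q (y : option (J * 'I_M.+1)) : E :=
  if y is Some (x, l) then (if l == ord0 then p x else r (lv l x)) else r a.
pose fixed (y : option (J * 'I_M.+1)) := if y is Some (x, l) then l == ord0 else false.
pose base (x : J) : option (J * 'I_M.+1) := Some (x, ord0).
have row0 x : grid_node M 0 x = base x by congr (Some (_, _)); apply: val_inj; rewrite /= inordK.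
have fixedP y : fixed y -> exists x, y = base x.
  by case: y => // [[x l]] /eqP ->; exists x.
have cf : (3 < #|fixed|)%N.
  apply: leq_trans J3 _; rewrite -(card_codom (f := base)); last by move=> x y [].
  by apply/subset_leq_card/fintype.subsetP => _ /codomP [x ->]; rewrite unfold_in /=.
have gq : general_position_on (enum fixed) q.
  move=> i j m l; rewrite !mem_enum => /fixedP [x ->] /fixedP [y ->] /fixedP [z ->] /fixedP [t ->] u.
  apply: gpp; move: u; rewrite -[ [:: _; _; _; _] ]/(map base [:: x; y; z; t]) map_inj_uniq //.
  by move=> ? ? [].
have [p' [p'f p'e gp']] := general_position_extend e0 cf gq.
have p'b x : p' (base x) = p x by rewrite p'f.
pose F := grid M C1.
pose F2' := [seq (base T.1.1, base T.1.2, base T.2) | T <- F2].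
have bF : bounds F [seq (base d.1, base d.2) | d <- C1].
  by have := @grid_bounds J M C1 cC1; rewrite -/F; under eq_map do rewrite !row0.
have bF2' : bounds F2' [seq (base d.1, base d.2) | d <- C2] by exact: bounds_map.
transitivity (crossings p' F2' F).
  rewrite (crossings_bounds _ _ bF) big_map; apply: eq_bigr => T _; rewrite big_map.
  by apply: eq_bigr => d _; rewrite /icross /= !p'b.
have Fcase T : T \in F -> exists d, d \in C1 /\
   [\/ exists2 l, (l < M)%N & T = (grid_node M l d.1, grid_node M l d.2, grid_node M l.+1 d.2),
       exists2 l, (l < M)%N & T = (grid_node M l d.1, grid_node M l.+1 d.1, grid_node M l.+1 d.2) |
       T = (None, grid_node M M d.1, grid_node M M d.2)].
  rewrite !mem_cat => /or3P [] .
  - move=> /allpairsPdep [d [l [hd]]]; rewrite mem_iota => /andP [_ hl] ->.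
    by exists d; split => //; constructor 1; exists l.
  - move=> /allpairsPdep [d [l [hd]]]; rewrite mem_iota => /andP [_ hl] ->.
    by exists d; split => //; constructor 2; exists l.
  - by move=> /mapP [d hd ->]; exists d; split => //; constructor 3.
have rowE x y l m : (l <= M)%N -> (m <= M)%N -> (grid_node M l x == grid_node M m y) = (x == y) && (l == m).
  move=> lM mM; apply/eqP/andP => [[-> /(congr1 val)]|[/eqP -> /eqP -> //]].
  by rewrite /= !inordK // => ->.
have uF T T' : T \in F2' -> T' \in F -> uniq (verts T ++ verts T').
  move=> /mapP [T0 T0F ->] /Fcase [d [hd Td]].
  have [d12 _ _ _ _] := C1P _ hd.
  have := uF2 _ _ T0F hd; rewrite /verts /= !inE !negb_or !andbT -!andbA.
  case/and5P => n1 n2 n3 n4 /and5P [n5 n6 n7 n8 /andP [n9 _]].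
  have nl l : (l == l.+1) = false by rewrite ltn_eqF.
  have nl' l : (l.+1 == l) = false by rewrite gtn_eqF.
  case: Td => [[l lM ->]|[l lM ->]|->]; rewrite /= -!row0;
    rewrite !rowE // ?(ltnW lM) // ?(negPf n1) ?(negPf n2) ?(negPf n3) ?(negPf n4) ?(negPf n5)
      ?(negPf n6) ?(negPf n7) ?(negPf n8) ?(negPf n9) ?(negPf d12) ?nl ?nl' ?andbF //=.
rewrite crossingsC //.
rewrite (crossings_bounds _ _ bF2') big1_seq // => T /= /Fcase [d [hd Td]].
rewrite big1_seq // => _ /= /mapP [e' /C2P [y K2y [h1 h2]] ->].
apply/negP => /=; rewrite /icross /= !p'b.
have [d12 k1 k2 k12 [pk1 pk2]] := C1P _ hd.
have near l x : K1 (k x) -> `|p x - k x| < e -> (l <= M)%N -> `|p' (grid_node M l x) - r (lv l x)| < e.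
  move=> kx pkx lM; case: l lM => [_|l lM].
    by rewrite row0 p'b /lv mul0r scale0r addr0 rK1.
  suff -> : r (lv l.+1 x) = q (grid_node M l.+1 x) by exact: p'e.
  rewrite /q /grid_node; case: eqP => [/(congr1 val)|_]; first by rewrite /= inordK.
  by rewrite inordK.
have tl l : (l <= M)%N -> 0 <= (l%:R / M%:R : R) <= 1.
  by move=> lM; rewrite divr_ge0 ?ler0n //= ler_pdivrMr ?ltr0n // mul1r ler_nat.
have adj1 l x w : `|k x - k w| < e -> (l <= M)%N -> `|lv l x - lv l w| < delta / 2.
  move=> kxw lM; have /andP [t0 t1] := tl l lM.
  have -> : lv l x - lv l w = (1 - l%:R / M%:R) *: (k x - k w).
    by apply/rowP => i; rewrite !mxE; ring.
  rewrite normrZ ger0_norm ?subr_ge0 //; apply: lt_le_trans e2; apply: le_lt_trans kxw.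
  by rewrite ler_piMl // gerBl.
have adj2 l x : K1 (k x) -> `|lv l x - lv l.+1 x| < delta / 2.
  move=> kx; have -> : lv l x - lv l.+1 x = - M%:R^-1 *: (a - k x).
    by apply/rowP => i; rewrite !mxE -[l.+1]addn1 natrD; ring.
  rewrite normrZ normrN ger0_norm ?invr_ge0 ?ler0n //; apply: le_lt_trans MB.
  by rewrite mulrC ler_wpM2r ?invr_ge0 ?ler0n //; exact: K1B.
have rA' l m x w : K1 (k x) -> K1 (k w) -> (l <= M)%N -> (m <= M)%N ->
    `|lv l x - lv m w| < delta -> `|r (lv l x) - r (lv m w)| < rho.
  by move=> kx kw lM mM; apply: rA => //; exact: tl.
have lvM x : lv M x = a.
  by rewrite /lv divff ?pnatr_eq0 -?lt0n // scale1r addrC subrK.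
have far (c v1 v2 v3 : E) u : c = r u ->
   `|v1 - c| < 2 * rho -> `|v2 - c| < 2 * rho -> `|v3 - c| < 2 * rho ->
   cross v1 v2 v3 (p e'.1) (p e'.2) -> False.
  move=> cu c1 c2 c3 cr.
  have w1 : `|p e'.1 - y| < 2 * rho by move: h1 e1 rho0; lra.
  have w2 : `|p e'.2 - y| < 2 * rho by move: h2 e1 rho0; lra.
  have := cross_near cr c1 c2 c3 w1 w2.
  by have := rK2 u y K2y; rewrite -cu; move: rho0; lra.
have tri (v c c' : E) : `|v - c'| < e -> `|c - c'| < rho -> `|v - c| < 2 * rho.
  move=> vc cc; rewrite -[v](subrK c') -addrA; apply: le_lt_trans (ler_normD _ _) _.
  by rewrite [`|c' - c|]distrC; move: vc cc e1; lra.
have tri0 (v c : E) : `|v - c| < e -> `|v - c| < 2 * rho by move: rho0 e1; lra.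
have dd : delta / 2 < delta by move: delta0; lra.
have adj12 l : `|lv l d.1 - lv l d.2| < delta / 2 -> `|lv l d.1 - lv l.+1 d.2| < delta.
  move=> h; rewrite -[lv l d.1](subrK (lv l d.2)) -addrA; apply: le_lt_trans (ler_normD _ _) _.
  by have := adj2 l d.2 k2; move: h; lra.
case: Td => [[l lM ->]|[l lM ->]|->] /=.
- apply: (far (r (lv l d.1)) _ _ _ (lv l d.1)) => //.
  + by apply: tri0; apply: near => //; exact: ltnW.
  + apply: (tri _ _ (r (lv l d.2))); first by apply: near => //; exact: ltnW.
    apply: rA' => //; rewrite ?(ltnW lM) //; apply: lt_trans dd.
    by apply: adj1 => //; exact: ltnW.
  + apply: (tri _ _ (r (lv l.+1 d.2))); first exact: near.
    by apply: rA' => //; rewrite ?(ltnW lM) //; apply: adj12; apply: adj1 => //; exact: ltnW.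
- apply: (far (r (lv l d.1)) _ _ _ (lv l d.1)) => //.
  + by apply: tri0; apply: near => //; exact: ltnW.
  + apply: (tri _ _ (r (lv l.+1 d.1))); first exact: near.
    apply: rA' => //; rewrite ?(ltnW lM) //; apply: lt_trans dd.
    exact: adj2.
  + apply: (tri _ _ (r (lv l.+1 d.2))); first exact: near.
    by apply: rA' => //; rewrite ?(ltnW lM) //; apply: adj12; apply: adj1 => //; exact: ltnW.
- apply: (far (r a) _ _ _ a) => //.
  + by apply: tri0; exact: (p'e None).
  + by apply: tri0; rewrite -[X in r X](lvM d.1); exact: near.
  + by apply: tri0; rewrite -[X in r X](lvM d.2); exact: near.
Qed.
End Unlinked.

(** * Separation by spheres *)

Section Sphere.
Variable R : realType.

Definition sqnorm n (x : 'rV[R]_n) : R := \sum_i x ord0 i ^+ 2.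

Lemma sqnorm_ge0 n (x : 'rV[R]_n) : 0 <= sqnorm x.
Proof. by apply: sumr_ge0 => i _; exact: sqr_ge0. Qed.

Lemma sqnorm_eq0 n (x : 'rV[R]_n) : sqnorm x = 0 -> x = 0.
Proof.
move=> /eqP; rewrite psumr_eq0 => [/allP h|i _]; last exact: sqr_ge0.
apply/rowP => i; rewrite mxE; apply/eqP; rewrite -sqrf_eq0.
by have := h i (mem_index_enum _); rewrite implyTb.
Qed.

Lemma sqnormZ n (k : R) (x : 'rV[R]_n) : sqnorm (k *: x) = k ^+ 2 * sqnorm x.
Proof. by rewrite /sqnorm mulr_sumr; apply: eq_bigr => i _; rewrite mxE exprMn. Qed.

Lemma sqnorm_continuous n : continuous (@sqnorm n : 'rV[R]_n -> R^o).
Proof.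
rewrite /sqnorm; elim: (index_enum _) => [|i s IH] x.
  have -> : (fun v : 'rV[R]_n => \sum_(i <- [::]) v ord0 i ^+ 2) = fun=> 0.
    by apply/funext => v; rewrite big_nil.
  exact: cst_continuous.
have -> : (fun v : 'rV[R]_n => \sum_(j <- i :: s) v ord0 j ^+ 2) =
    (fun v : 'rV[R]_n => v ord0 i * v ord0 i) \+ (fun v : 'rV[R]_n => \sum_(j <- s) v ord0 j ^+ 2).
  by apply/funext => v; rewrite big_cons expr2.
apply: continuousD; last exact: IH.
apply: continuousM; exact: coord_continuous.
Qed.

Lemma coord_le_sqnorm n (x : 'rV[R]_n) i : x ord0 i ^+ 2 <= sqnorm x.
Proof.
rewrite /sqnorm (bigD1 i) //= lerDl; apply: sumr_ge0 => j _; exact: sqr_ge0.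
Qed.

Lemma sphere_compact n : compact (sphere R n).
Proof.
apply: bounded_closed_compact.
  exists 1; split; first exact: num_real.
  move=> M M1 x /= sx; apply: ltW; apply: norm_rV_lt; first by apply: lt_trans M1.
  move=> i; apply: le_lt_trans M1.
  by rewrite -[1]ger0_norm // -ler_sqr ?nnegrE // !real_normK ?num_real // expr1n -sx coord_le_sqnorm.
rewrite (_ : sphere R n = @sqnorm n.+1 @^-1` [set 1]) //.
by apply: (preimage_closed _ (@closed_eq R 1)) => y _; exact: sqnorm_continuous.
Qed.

(* Since the segment from x to -p misses 0 unless x = p, this contracts the sphere
   minus p to -p. *)
Definition contraction n (p : 'rV[R]_n) (x : 'rV[R]_n) (t : R) : 'rV[R]_n :=
  let w := (1 - t) *: x - t *: p in (Num.sqrt (sqnorm w))^-1 *: w.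

Section Contraction.
Variables (n : nat) (p : 'rV[R]_n.+1).
Hypothesis sp : sphere R n p.

Lemma contraction_sqnorm_gt0 x t : sphere R n x -> x <> p -> 0 <= t <= 1 ->
  0 < sqnorm ((1 - t) *: x - t *: p).
Proof.
move=> sx xp /andP [t0 t1]; rewrite lt_def sqnorm_ge0 andbT; apply/eqP => /sqnorm_eq0 /eqP.
rewrite subr_eq0 => /eqP h.
have := congr1 (@sqnorm _) h; rewrite !sqnormZ (_ : sqnorm x = 1) // (_ : sqnorm p = 1) // !mulr1.
move=> /eqP; rewrite eqrXn2 ?subr_ge0 // => /eqP ht.
apply: xp; have t12 : t != 0 by apply/eqP; lra.
by move: h; rewrite ht => /(scalerI t12).
Qed.

(** The motion must never reach [p], because the parametrised sphere may send [p] to the point at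
    infinity. A positive multiple of [p] on the segment from [x] to [-p] would force [x = p]. *)
Lemma contraction_sphere x t : sphere R n x -> x <> p -> 0 <= t <= 1 ->
  sphere R n (contraction p x t) /\ contraction p x t <> p.
Proof.
move=> sx xp t01; have w0 := contraction_sqnorm_gt0 sx xp t01.
case/andP: t01 => t0 t1.
rewrite /contraction; set w := _ - _ in w0 *; split.
  change (sqnorm ((Num.sqrt (sqnorm w))^-1 *: w) = 1).
  by rewrite sqnormZ exprVn sqr_sqrtr ?(ltW w0) // mulVf // gt_eqF.
set k := (Num.sqrt _)^-1; have k0 : 0 < k by rewrite invr_gt0 sqrtr_gt0.
move=> h; have hw : (1 - t) *: x = (t + k^-1) *: p.
  by rewrite [RHS]scalerDl -[X in _ = _ + k^-1 *: X]h scalerA mulVf ?gt_eqF // scale1r /w [RHS]addrC subrK.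
have := congr1 (@sqnorm _) hw; rewrite !sqnormZ (_ : sqnorm x = 1) // (_ : sqnorm p = 1) // !mulr1.
have ki : 0 < k^-1 by rewrite invr_gt0.
have a0 : 0 <= 1 - t by rewrite subr_ge0.
have b0 : 0 <= t + k^-1 by rewrite addr_ge0 // ltW.
move=> /eqP; rewrite eqrXn2 // => /eqP ht.
apply: xp; have tk : t + k^-1 != 0 by rewrite gt_eqF // ltr_wpDl.
by move: hw; rewrite ht => /(scalerI tk).
Qed.

Lemma contraction0 x : sphere R n x -> contraction p x 0 = x.
Proof.
move=> sx; rewrite /contraction subr0 scale1r scale0r subr0.
by rewrite (_ : sqnorm x = 1) // sqrtr1 invr1 scale1r.
Qed.

Lemma contraction1 x : contraction p x 1 = - p.
Proof.
rewrite /contraction subrr scale0r sub0r scale1r -scaleN1r sqnormZ (_ : sqnorm p = 1) //.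
by rewrite mulr1 sqrrN expr1n sqrtr1 invr1 scale1r.
Qed.

Lemma contraction_cont : cont_on [set z : 'rV[R]_n.+1 * R^o | sphere R n z.1 /\ z.1 <> p /\ 0 <= z.2 <= 1]
  (fun z => contraction p z.1 z.2).
Proof.
apply/cont_onP/subspace_continuousP => -[x t] [/= sx [xp t01]].
apply: cvg_within_filter.
have w0 := contraction_sqnorm_gt0 sx xp t01.
have cw : (1 - z.2) *: z.1 - z.2 *: p @[z --> nbhs ((x, t) : 'rV[R]_n.+1 * R^o)] --> (1 - t) *: x - t *: p.
  apply: cvgB.
    by apply: cvgZ; [apply: cvgB; [exact: cvg_cst|exact: cvg_snd]|exact: cvg_fst].
  by apply: cvgZ; [exact: cvg_snd|exact: cvg_cst].
have cq : sqnorm ((1 - z.2) *: z.1 - z.2 *: p) @[z --> nbhs ((x, t) : 'rV[R]_n.+1 * R^o)]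
    --> sqnorm ((1 - t) *: x - t *: p).
  exact: (cvg_comp _ _ cw (@sqnorm_continuous _ _)).
have cr : Num.sqrt (sqnorm ((1 - z.2) *: z.1 - z.2 *: p)) @[z --> nbhs ((x, t) : 'rV[R]_n.+1 * R^o)]
    --> Num.sqrt (sqnorm ((1 - t) *: x - t *: p)).
  exact: (cvg_comp _ _ cq (@sqrt_continuous _ _)).
have ci : (Num.sqrt (sqnorm ((1 - z.2) *: z.1 - z.2 *: p)))^-1 @[z --> nbhs ((x, t) : 'rV[R]_n.+1 * R^o)]
    --> (Num.sqrt (sqnorm ((1 - t) *: x - t *: p)))^-1.
  by apply: (cvgV _ cr); rewrite gt_eqF // sqrtr_gt0.
exact: (cvgZ ci cw).
Qed.
End Contraction.
End Sphere.

(** * Fine polygons in a split link *)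

Section Split.
Variable R : realType.
Notation E := 'rV[R]_3.

Lemma exists_normal (u v : E) : exists n : E, [/\ n != 0, dot n u = 0 & dot n v = 0].
Proof.
pose M := row_mx u^T v^T.
have : kermx M != 0.
  by rewrite kermx_eq0 /row_free; apply/eqP => h; have := rank_leq_col M; rewrite h.
rewrite -nz_row_eq0 => n0.
have /sub_kermxP nM : (nz_row (kermx M) <= kermx M)%MS by exact: nz_row_sub.
have dotE (n w : E) : dot n w = (n *m w^T) ord0 ord0.
  rewrite mxE /dot !big_ord_recl big_ord0 addr0 addrA !mxE.
  by congr (_ * _ + _ * _ + _ * _); congr (fun_of_matrix _ _ _); apply: val_inj.
exists (nz_row (kermx M)); split => //; rewrite dotE.
  by have := congr1 lsubmx nM; rewrite mul_mx_row row_mxKl => ->; rewrite !mxE.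
by have := congr1 rsubmx nM; rewrite mul_mx_row row_mxKr => ->; rewrite !mxE.
Qed.

(** Take [a] off the planes through [p] and each of the lines. A segment from [x] in [K] to [a] then
    meets the plane of the line of [x] only in [x], which is not [p]. *)
Lemma cone_avoids (K : set E) (p : E) (lines : seq (E * E)) :
  ~ K p ->
  (forall x, K x -> exists2 l, l \in lines & exists t, x = l.1 + t *: (l.2 - l.1)) ->
  exists a, forall x t, K x -> 0 <= t <= 1 -> x + t *: (a - x) != p.
Proof.
move=> Kp hK.
have [N NP] : {N : E * E -> E & forall l, [/\ N l != 0, dot (N l) (l.1 - p) = 0 & dot (N l) (l.2 - p) = 0]}.
  apply: (@choice _ _ (fun (l : E * E) n => [/\ n != 0, dot n (l.1 - p) = 0 & dot n (l.2 - p) = 0])) => l.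
  exact: exists_normal.
have [|a _ ha] := @avoid_planes R [seq (N l, dot (N l) p) | l <- lines] 0 1 ltr01.
  by move=> _ /mapP [l _ ->] /=; have [] := NP l.
exists a => x t Kx t01; apply/eqP => h.
have [l ll [s xs]] := hK x Kx.
have [_ n1 n2] := NP l.
have := ha _ (map_f (fun l => (N l, dot (N l) p)) ll) => /=.
have dx : dot (N l) x = dot (N l) p.
  have : dot (N l) x - dot (N l) p = (1 - s) * dot (N l) (l.1 - p) + s * dot (N l) (l.2 - p).
    by rewrite xs /dot !mxE; ring.
  by rewrite n1 n2 !mulr0 addr0 => /eqP; rewrite subr_eq0 => /eqP.
have : t * (dot (N l) a - dot (N l) p) = 0.
  have : dot (N l) (x + t *: (a - x)) = dot (N l) p by rewrite h.
  rewrite (_ : dot _ _ = (1 - t) * dot (N l) x + t * dot (N l) a); last by rewrite /dot !mxE; ring.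
  by rewrite dx; lra.
move=> /eqP; rewrite mulf_eq0 => /orP [/eqP t0|]; last by rewrite subr_eq0 => ->.
by case: Kp; rewrite -h t0 scale0r addr0.
Qed.

Definition fine_unlinked (K1 K2 : set E) := exists2 e, 0 < e & unlinked_at K1 K2 e.

Lemma unlinked_at_le (K1 K2 : set E) (e e' : R) :
  e' <= e -> unlinked_at K1 K2 e -> unlinked_at K1 K2 e'.
Proof.
move=> ee U J p k C1 C2 F2 gpp J3 cC h1 h2; apply: (U J p k) => // d hd.
  have [a b c x [y z]] := h1 d hd.
  by split => //; [exact: lt_le_trans ee|split; exact: lt_le_trans ee].
by have [y Ky [a b]] := h2 d hd; exists y => //; split; exact: lt_le_trans ee.
Qed.

Lemma cont_on_comp (U V W : pseudoMetricNormedZmodType R) (A : set U) (B : set V)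
    (f : U -> V) (k : V -> W) :
  cont_on A f -> cont_on B k -> f @` A `<=` B -> cont_on A (k \o f).
Proof.
move=> cf ck fAB x Ax e e0.
have fx y : A y -> B (f y) by move=> Ay; apply: fAB; exists y.
have [d d0 hd] := ck _ (fx _ Ax) e e0.
have [d' d'0 hd'] := cf _ Ax d d0.
by exists d' => // y Ay xy; apply: hd; [exact: fx|exact: hd'].
Qed.

Lemma cont_on_fst (U V W : pseudoMetricNormedZmodType R) (A : set U) (B : set W) (f : U -> V) :
  cont_on A f -> cont_on (A `*` B) (fun z : U * W => (f z.1, z.2)).
Proof.
move=> cf [x t] [/= Ax Bt] e e0; have [d d0 hd] := cf x Ax e e0.
exists (Num.min d e); first by rewrite lt_min d0.
move=> [y u] [/= Ay Bu]; rewrite prod_normE gt_max !lt_min /= => /andP [/andP [xy _] /andP [_ tu]].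
by rewrite prod_normE gt_max /= hd.
Qed.

(** This instantiates [push_into] in space, with [W] the preimage under [g] of the component of [X1]
    and with the contraction of the round sphere minus [p], transported by [s] and [h]. *)
Lemma split_fine (q : 'rV[R]_4) (h : 'rV[R]_4 -> E) (X1 X2 S : set 'rV[R]_4)
    (s : E -> 'rV[R]_4) (lines : seq (E * E)) (x0 : 'rV[R]_4) :
  homeomorphism (sphere R 3 `\ q) [set: E] h ->
  compact X1 -> compact X2 -> X1 `<=` sphere R 3 `\ q -> X2 `<=` sphere R 3 `\ q ->
  embedding (sphere R 2) (sphere R 3) s -> S = s @` sphere R 2 ->
  X2 `&` S = set0 -> X1 x0 ->
  (forall x, X1 x -> connected_component (sphere R 3 `\` S) x0 x) ->
  (forall y, X2 y -> ~ connected_component (sphere R 3 `\` S) x0 y) ->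
  (forall x, X1 x -> exists2 l, l \in lines & exists t, h x = l.1 + t *: (l.2 - l.1)) ->
  fine_unlinked (h @` X1) (h @` X2).
Proof.
move=> [ch [hmap hinj hsurj] [g [cg0 gK]]] cX1 cX2 X1s X2s.
have cg : continuous g := (continuous_subspace_setT g).2 cg0.
move=> [sS [cs [_ sinj _] [sg [csg sgK]]]] SE X2S X1x0 cc1 cc2 hl.
have ghK x : (sphere R 3 `\ q) x -> g (h x) = x by move=> Px; apply: gK; rewrite inE.
have hgP y : (sphere R 3 `\ q) (g y) /\ h (g y) = y.
  by have [x Px <-] := hsurj y I; rewrite ghK.
have sgK' x : sphere R 2 x -> sg (s x) = x by move=> sx; apply: sgK; rewrite inE.
have cS : compact S by rewrite SE; apply: continuous_compact => //; exact: sphere_compact.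
have clS : closed S by apply: compact_closed => //; exact: norm_hausdorff.
pose S' := g @^-1` S.
have clS' : closed S' by apply: (preimage_closed _ clS) => x _; exact: cg.
pose K1 := h @` X1; pose K2 := h @` X2.
have cK1 : compact K1.
  by apply: continuous_compact => //; exact: continuous_subspaceW ch.
have cK2 : compact K2.
  by apply: continuous_compact => //; exact: continuous_subspaceW ch.
pose W := [set u | connected_component (sphere R 3 `\` S) x0 (g u)].
have K1W : K1 `<=` W.
  by move=> _ [x X1x <-]; rewrite /W /= ghK; [exact: cc1|exact: X1s].
have K2P k : K2 k -> ~ W k /\ ~ S' k.
  move=> [y X2y <-]; rewrite /W /S' /= ghK; last exact: X2s.
  split; first exact: cc2.
  by move=> Sy; rewrite -[False]/(set0 y) -X2S.
have sep x y : W x -> ~ W y -> exists2 t, 0 <= t <= 1 & S' (x + t *: (y - x)).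
  move=> Wx Wy; apply: contrapT => hn; apply: Wy.
  apply: connected_component_trans Wx _.
  pose f (t : R) := g (x + t *: (y - x)).
  exists (f @` `[0, 1]).
    split.
    - by exists 0; rewrite /= ?in_itv /= ?lexx ?ler01 // /f scale0r addr0.
    - move=> _ [t /= + <-]; rewrite in_itv /= => t01; split; first by have [[]] := hgP (x + t *: (y - x)).
      by move=> St; apply: hn; exists t.
    - apply: connected_continuous_connected; first exact: segment_connected.
      apply: continuous_subspaceT => t; rewrite /f.
      have cl : x + u *: (y - x) @[u --> t] --> x + t *: (y - x).
        by apply: cvgD; [exact: cvg_cst|apply: cvgZ; [exact: cvg_id|exact: cvg_cst]].
      exact: (cvg_comp _ _ cl (cg _)).
  by exists 1; rewrite /= ?in_itv /= ?lexx ?ler01 // /f scale1r addrC subrK.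
have [M1 K1M] : exists M, forall x, K1 x -> `|x| <= M.
  have [M [_ hM]] := compact_bounded cK1.
  by exists (M + 1) => x Kx; apply: hM => //; rewrite ltrDl.
have S1 x : K1 x -> ~ S' x.
  by move=> Kx Sx; have /connected_component_sub [] := K1W _ Kx.
(* If [S] contains [q], the point [p] lying over [q] is removed and any apex serves. Otherwise
   [h (s p)] is a point of space, and a generic apex keeps the cone at positive distance from it;
   [D] contains the [eta]-neighbourhood of the cone. *)
have [p [a [D [eta [sp [eta0 clD AD Dp qp]]]]]] : exists p (a : E) (D : set E) eta,
    sphere R 2 p /\ [/\ 0 < eta, closed D,
      forall x t u, K1 x -> 0 <= t <= 1 -> `|x + t *: (a - x) - u| < eta -> D u,
      forall u, D u -> g u <> s p & forall x, sphere R 2 x -> x <> p -> s x <> q].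
  have [Sq|Sq] := pselect (S q).
    move: Sq; rewrite SE => -[p sp spq].
    exists p, 0, setT, 1; split => //; split => //.
      by move=> u _; rewrite spq; have [[]] := hgP u.
    by move=> x sx xp; rewrite -spq => /sinj xp'; apply: xp; apply: xp'; rewrite inE.
  pose p : E := vec3 1 0 0.
  have sp : sphere R 2 p.
    by rewrite /sphere /= !big_ord_recl big_ord0 !mxE /= expr1n !expr0n /= !addr0.
  have Psp : (sphere R 3 `\ q) (s p).
    by split; [apply: sS; exists p|move=> /= spq; apply: Sq; rewrite -spq SE; exists p].
  have [||a ha] := @cone_avoids K1 (h (s p)) lines.
  - by move=> K; apply: (S1 _ K); rewrite /S' /= ghK // SE; exists p.
  - by move=> _ [x X1x <-]; exact: hl.
  have cA : compact ((fun z : E * R^o => z.1 + z.2 *: (a - z.1)) @` (K1 `*` `[0, 1]%classic)).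
    apply: continuous_compact; last by apply: compact_setX => //; exact: segment_compact.
    apply: continuous_subspaceT => z.
    have cl : u.1 + u.2 *: (a - u.1) @[u --> z] --> z.1 + z.2 *: (a - z.1).
      apply: cvgD; first exact: cvg_fst.
      apply: cvgZ; first exact: cvg_snd.
      by apply: cvgB; [exact: cvg_cst|exact: cvg_fst].
    exact: cl.
  have [||d d0 hd] := @compact_closed_dist R E _ [set h (s p)] cA.
  - by apply: compact_closed; [exact: norm_hausdorff|exact: compact_set1].
  - rewrite -subset0 => _ [[[x t] [/= Kx]] ] + <- /= => /[!in_itv] /= t01 /eqP.
    by apply/negP; exact: ha.
  exists p, a, [set u | d / 2 <= `|h (s p) - u|], (d / 2); split => //; split => //.
  - by rewrite divr_gt0.
  - rewrite (_ : [set u | _] = ~` ball (h (s p)) (d / 2)).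
      by apply: open_closedC; apply: ball_open; rewrite divr_gt0.
    rewrite -ball_normE; apply/seteqP; split => u /=; first by rewrite leNgt => /negP.
    by move/negP; rewrite -leNgt.
  - move=> x t u Kx t01 xu /=.
    have : d <= `|x + t *: (a - x) - h (s p)|.
      apply: hd => //; exists (x, t) => //; split => //=; by rewrite in_itv.
    rewrite -[x + t *: (a - x)](subrK u) -addrA => hh.
    have := le_trans hh (ler_normD _ _); rewrite [`|u - _|]distrC; move: xu; lra.
  - move=> u /= + gus; rewrite -gus (hgP u).2 subrr normr0.
    by rewrite leNgt divr_gt0.
  - by move=> x sx xp sxq; apply: Sq; rewrite -sxq SE; exists x.
(* [S'] is unbounded when [S] passes through [q]; the bound on the norm, valid in the
   [eta]-neighbourhood of the cone, makes [C] compact. *)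
pose C := S' `&` D `&` [set x | `|x| <= M1 + (`|a| + M1) + eta].
pose A := [set u | exists x t, [/\ K1 x, 0 <= t <= 1 & u = x + t *: (a - x)]].
have CA u x : A u -> S' x -> `|u - x| < eta -> C x.
  move=> [y [t [Ky t01 ->]]] Sx yx; split; first split => //; first exact: AD yx.
  rewrite /= -[x](subrK (y + t *: (a - y))) addrC; apply: le_trans (ler_normD _ _) _.
  apply: lerD; last by rewrite distrC ltW.
  apply: le_trans (ler_normD _ _) _; apply: lerD; first exact: K1M.
  case/andP: t01 => t0 t1; rewrite normrZ ger0_norm //.
  apply: le_trans (ler_piMl (normr_ge0 _) t1) _; apply: le_trans (ler_normB _ _) _.
  by rewrite lerD2l K1M.
have cC : compact C.
  apply: bounded_closed_compact.
    exists (M1 + (`|a| + M1) + eta); split; first exact: num_real.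
    by move=> M hM x [_ /= /le_trans]; apply; exact: ltW.
  apply: closedI; first exact: closedI.
  rewrite (_ : [set x | _] = closed_ball_ (fun x : E => `|x|) 0 (M1 + (`|a| + M1) + eta)); first exact: closed_closed_ball_.
  by rewrite /closed_ball_; apply/seteqP; split => x /=; rewrite sub0r normrN.
pose y0 x := sg (g x).
have y0P x : C x -> [/\ sphere R 2 (y0 x), s (y0 x) = g x & y0 x <> p].
  move=> [[Sx Dx] _]; move: (Sx); rewrite /S' /= SE => -[y sy syg].
  rewrite /y0 -syg sgK' //; split => // yp.
  by apply: (Dp x Dx); rewrite -syg yp.
have psP z : sphere R 2 z -> z <> p -> (sphere R 3 `\ q) (s z) /\ S' (h (s z)).
  move=> sz zp; have Pz : (sphere R 3 `\ q) (s z).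
    by split; [apply: sS; exists z|exact: qp].
  by split => //; rewrite /S' /= ghK // SE; exists z.
pose Phi x t := h (s (contraction p (y0 x) t)).
pose z0 := h (s (- p)).
have PhiS x t : C x -> 0 <= t <= 1 -> S' (Phi x t).
  move=> Cx t01; have [sy syg yp] := y0P x Cx.
  have [sz zp] := contraction_sphere sp sy yp t01.
  by have [] := psP _ sz zp.
have Sz0 : S' z0.
  apply: (psP _ _ _).2.
    by change (sqnorm (- p) = 1); rewrite -scaleN1r sqnormZ sqrrN expr1n mul1r.
  move=> pp; have p0 : p = 0.
    by apply/rowP => i; have := congr1 (fun v : E => v ord0 i) pp; rewrite !mxE; lra.
  by move: sp; rewrite p0 /sphere /= big1 => [/eqP|i _]; rewrite ?mxE ?expr0n // eq_sym oner_eq0.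
have [r2 r20 hr2] : exists2 d, 0 < d & forall k w, K2 k -> S' w -> d <= `|k - w|.
  apply: compact_closed_dist => //; rewrite -subset0 => k [Kk Sk].
  by have [] := K2P k Kk.
have cPhi : cont_on (C `*` `[0, 1] : set (E * R^o)) (fun z => Phi z.1 z.2).
  have c1 : cont_on C y0.
    apply: (@cont_on_comp _ _ _ C S g sg).
    - by apply/cont_onP; apply: continuous_subspaceT.
    - by rewrite SE; apply/cont_onP.
    - by move=> _ [x [[Sx _] _] <-].
  have c2 := cont_on_comp (@cont_on_fst _ _ R^o C `[0, 1]%classic _ c1) (contraction_cont sp).
  have c3 : cont_on (sphere R 2 `\ p) s.
    by apply/cont_onP; apply: continuous_subspaceW cs => x [].
  have c4 := (cont_onP _ _).1 ch.
  have c5 := cont_on_comp c3 c4.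
  have c6 := cont_on_comp (c2 _) (c5 _).
  apply: c6.
  - move=> _ [[x t] [/= Cx]] /[!in_itv] /= t01 <- /=.
    by have [sy _ yp] := y0P x Cx.
  - by move=> _ [z [sz zp] <-]; have [] := psP _ sz zp.
  - move=> _ [[x t] [/= Cx]] /[!in_itv] /= t01 <- /=.
    by have [sy _ yp] := y0P x Cx; exact: (contraction_sphere sp sy yp t01).
have cCI : compact (C `*` `[0, 1] : set (E * R^o)).
  by apply: compact_setX => //; exact: segment_compact.
have uPhi e : 0 < e -> exists2 d, 0 < d & forall x y s t, C x -> C y -> 0 <= s <= 1 ->
     0 <= t <= 1 -> `|x - y| < d -> `|s - t| < d -> `|Phi x s - Phi y t| < e.
  move=> e0; have [d d0 hd] := cont_on_unif cCI cPhi e0.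
  exists d => // x y u t Cx Cy u01 t01 xy ut.
  have z1 : (C `*` `[0, 1]) (x, u) by split => //=; rewrite in_itv.
  have z2 : (C `*` `[0, 1]) (y, t) by split => //=; rewrite in_itv.
  have z12 : `|(x, u) - (y, t) : E * R^o| < d by rewrite prod_normE gt_max /= xy ut.
  exact: hd z1 z2 z12.
have [|||r [rho [delta [rho0 delta0 rK1 rK2 rA]]]] :=
   @push_into R E K1 K2 W S' A C Phi z0 eta r2 cK2 clS' K1W K2P sep eta0 CA uPhi _ r20 _ _.
- move=> x Cx; have [sy syg yp] := y0P x Cx; split.
    by rewrite /Phi contraction0 // syg; have [] := hgP x.
  by rewrite /Phi contraction1.
- by move=> k x t Kk Cx t01; apply: hr2 => //; exact: PhiS.
- by move=> k Kk; apply: hr2.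
apply: (@unlinked R K1 K2 a (`|a| + M1) r rho delta) => //.
  by move=> x Kx; apply: le_trans (ler_normB _ _) _; rewrite lerD2l K1M.
move=> x y u t Kx Ky u01 t01 /= uv; apply: rA => //; first by exists x, u.
by exists y, t.
Qed.
End Split.

(** * Disks in a subdivided tournament *)

Section Moment.
Variable R : realType.

Definition moment (i : nat) : 'rV[R]_3 := vec3 i%:R (i%:R ^+ 2) (i%:R ^+ 3).

Definition odd_inversions (a b c d : nat) : bool :=
  (b < a)%N (+) ((c < a)%N (+) ((d < a)%N (+) ((c < b)%N (+) ((d < b)%N (+) (d < c)%N)))).

Lemma sg_subn (a b : nat) : a != b -> Num.sg (b%:R - a%:R : R) = (-1) ^+ (b < a)%N.
Proof.
move=> ab; have [ba|] := ltnP b a; first by rewrite ltr0_sg // subr_lt0 ltr_nat.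
by rewrite leq_eqVlt (negPf ab) /= => h; rewrite gtr0_sg // subr_gt0 ltr_nat.
Qed.

(** The orientation of four points of the moment curve is a Vandermonde product, so its sign is the
    parity of the inversions of the parameters. *)
Lemma sg_orient_moment a b c d : uniq [:: a; b; c; d] ->
  Num.sg (orient (moment a) (moment b) (moment c) (moment d)) = (-1) ^+ odd_inversions a b c d.
Proof.
rewrite /= !inE !negb_or => /and4P [/and3P [ab ac ad] /andP [bc bd] cd _].
have -> : orient (moment a) (moment b) (moment c) (moment d) =
   (b%:R - a%:R) * ((c%:R - a%:R) * ((d%:R - a%:R) * ((c%:R - b%:R) * ((d%:R - b%:R) * (d%:R - c%:R))))).
  by rewrite orientE /moment !mxE /=; ring.
by rewrite !sgrM !sg_subn // /odd_inversions !signr_addb.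
Qed.

Lemma orient_moment_neq0 a b c d : uniq [:: a; b; c; d] ->
  orient (moment a) (moment b) (moment c) (moment d) != 0.
Proof. by move=> u; rewrite -sgr_eq0 sg_orient_moment // signr_eq0. Qed.

(** Each entry is true when the corresponding entry of [radon] is negative. This form of [cross] can
    be evaluated by computation. *)
Definition moment_cross (a b c d e : nat) : bool :=
  let l := [:: odd_inversions b c d e; ~~ odd_inversions a c d e; odd_inversions a b d e;
              odd_inversions a b c e; ~~ odd_inversions a b c d] in
  all negb l (+) all id l.

Lemma cross_moment a b c d e : uniq [:: a; b; c; d; e] ->
  cross (moment a) (moment b) (moment c) (moment d) (moment e) = moment_cross a b c d e.
Proof.
move=> u.
have pos (x : R) (s : bool) : Num.sg x = (-1) ^+ s -> (0 < x) = ~~ s /\ (x < 0) = s.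
  by rewrite -sgr_gt0 -sgr_lt0 => ->; case: s; rewrite ?expr1 ?expr0 ?oppr_gt0 ?oppr_lt0 ?ltr01 ?ltr10.
have posN (x : R) (s : bool) : Num.sg x = (-1) ^+ s -> (0 < - x) = s /\ (- x < 0) = ~~ s.
  by rewrite oppr_gt0 oppr_lt0 => /pos [-> ->].
move: u; rewrite /= !inE !negb_or => /and5P [/and4P [ab ac ad ae] /and3P [bc bd be] /andP [cd ce] de _].
have u1 : uniq [:: b; c; d; e] by rewrite /= !inE !negb_or bc bd be cd ce de.
have u2 : uniq [:: a; c; d; e] by rewrite /= !inE !negb_or ac ad ae cd ce de.
have u3 : uniq [:: a; b; d; e] by rewrite /= !inE !negb_or ab ad ae bd be de.
have u4 : uniq [:: a; b; c; e] by rewrite /= !inE !negb_or ab ac ae bc be ce.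
have u5 : uniq [:: a; b; c; d] by rewrite /= !inE !negb_or ab ac ad bc bd cd.
have [p1 n1] := pos _ _ (sg_orient_moment u1); have [p2 n2] := posN _ _ (sg_orient_moment u2).
have [p3 n3] := pos _ _ (sg_orient_moment u3); have [p4 n4] := pos _ _ (sg_orient_moment u4).
have [p5 n5] := posN _ _ (sg_orient_moment u5).
by rewrite /cross /radon /moment_cross /= p1 p2 p3 p4 p5 n1 n2 n3 n4 n5 !negbK.
Qed.
End Moment.

(** * Cyclic lists and their fans *)

Section CyclicLists.
Variable T : eqType.

Lemma map_next_rot (c : seq T) : uniq c -> [seq next c u | u <- c] = rot 1 c.
Proof.
case: c => // y s u; rewrite rot1_cons; apply: (@eq_from_nth _ y).
  by rewrite size_map size_rcons.
move=> i; rewrite size_map => hi; rewrite (nth_map y) // next_nth mem_nth //.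
rewrite index_uniq // nth_rcons.
case: ltngtP => // [h|->]; last by rewrite nth_default.
by rewrite nth_default // ltnW.
Qed.

Lemma big_next (c : seq T) (g : T -> bool) : uniq c ->
  \big[addb/false]_(u <- c) (g u (+) g (next c u)) = false.
Proof.
move=> u; rewrite big_split /=.
have -> : \big[addb/false]_(i <- c) g (next c i) = \big[addb/false]_(i <- c) g i.
  by rewrite -(big_map (next c) xpredT) map_next_rot // (perm_big c) // perm_rot.
by rewrite addbb.
Qed.

Fixpoint fan (y a : T) (s : seq T) : seq (T * T * T) :=
  if s is b :: s' then (y, a, b) :: fan y b s' else [::].

Definition cyc_fan (c : seq T) : seq (T * T * T) :=
  if c is y :: a :: s then fan y a s else [::].

Definition arcs (c : seq T) : seq (T * T) := [seq (u, next c u) | u <- c].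

Lemma arcs_zip c : uniq c -> arcs c = zip c (rot 1 c).
Proof.
have H (f : T -> T) s : [seq (u, f u) | u <- s] = zip s (map f s) by elim: s => //= x s ->.
by move=> u; rewrite -map_next_rot // /arcs H.
Qed.

Lemma fan_sum (phi : T -> T -> bool) y a s : (forall x z, phi x z = phi z x) ->
  \big[addb/false]_(t <- fan y a s) boundary_sum phi t =
  phi y a (+) \big[addb/false]_(e <- zip (a :: s) (rcons s y)) phi e.1 e.2.
Proof.
move=> sphi; elim: s a => [|b s IH] a /=.
  by rewrite big_nil big_cons big_nil addbF /= sphi addbb.
rewrite !big_cons IH /boundary_sum /=.
set z := \big[_/_]_(_ <- _) _.
by case: (phi y a); case: (phi a b); case: (phi y b); case: z.
Qed.

Lemma cyc_fan_bounds c : uniq c -> (1 < size c)%N -> bounds (cyc_fan c) (arcs c).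
Proof.
move=> u; rewrite arcs_zip //; case: c u => // y [//|a s] u _ phi sphi.
by rewrite rot1_cons /= fan_sum // !big_cons.
Qed.

Lemma fan_vertices y a s t : uniq (y :: a :: s) -> t \in fan y a s ->
  uniq (verts t) && all (mem (y :: a :: s)) (verts t).
Proof.
elim: s a => // b s IH a u; rewrite inE => /orP [/eqP ->|h].
  move: u; rewrite /= !inE !negb_or !eqxx !orbT /= andbT.
  by case/and4P => /and3P [-> -> _] /andP [-> _].
have u' : uniq (y :: b :: s).
  by move: u; rewrite /= !inE !negb_or; case/and4P => /and3P [_ -> ->] _ -> ->.
have /andP [-> /allP hh] := IH b u' h.
apply/allP => x /hh /=; rewrite !inE => /or3P [->|->|->]; by rewrite ?orbT.
Qed.

Lemma cyc_fan_vertices c t : uniq c -> t \in cyc_fan c -> uniq (verts t) && all (mem c) (verts t).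
Proof. by case: c => // y [//|a s]; exact: fan_vertices. Qed.

Lemma big_addb_even (l : seq T) (f : T -> bool) :
  all (fun x => ~~ odd (count_mem x l)) l -> \big[addb/false]_(x <- l) f x = false.
Proof.
move=> /allP h; rewrite -big_undup_iterop_count big1_seq // => x /=; rewrite mem_undup => /h.
have it n b : iterop n addb b false = odd n && b.
  case: n => // n; rewrite iteropS; elim: n => [|n IH]; first by case: b.
  by rewrite iterS IH; case: (b); rewrite ?andbF ?andbT /=; case: (odd n).
by rewrite it => /negPf ->.
Qed.
End CyclicLists.

(** * Linking numbers of subdivided cycles *)

Section Config.
Variables (m N : nat).
Hypothesis N0 : (0 < N)%N.
Notation V := 'I_m.
(* Nodes: a reference copy of each vertex, each vertex itself, and the N - 1
   subdivision points of each arc. *)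
Definition node : finType := (V + (V + V * V * 'I_N.+1))%type.
Implicit Types (e : V * V) (c : seq V).

Definition ref_node (v : V) : node := inl v.
Definition vertex_node (v : V) : node := inr (inl v).
(** Positions 0 and [N] are identified with the vertex nodes, so that the polygons of consecutive
    arcs share their ends. *)
Definition arc_node e (i : nat) : node :=
  if i == 0%N then vertex_node e.1 else if i == N then vertex_node e.2 else inr (inr (e.1, e.2, inord i)).

(* A disk between an arc and the chord of the reference embedding. *)
Definition strip e : seq (node * node * node) :=
  [seq (ref_node e.1, arc_node e i, arc_node e i.+1) | i <- iota 0 N] ++
  [:: (ref_node e.1, ref_node e.2, vertex_node e.2)].
Definition poly_arc e : seq (node * node) := [seq (arc_node e i, arc_node e i.+1) | i <- iota 0 N].
Definition strips c := flatten [seq strip e | e <- arcs c].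
Definition poly_cycle c := flatten [seq poly_arc e | e <- arcs c].
Definition ref_fan c : seq (node * node * node) :=
  [seq (ref_node t.1.1, ref_node t.1.2, ref_node t.2) | t <- cyc_fan c].
Definition disk c := strips c ++ ref_fan c.

Lemma strip_sum (phi : node -> node -> bool) e : (forall x y, phi x y = phi y x) ->
  \big[addb/false]_(T <- strip e) boundary_sum phi T =
  \big[addb/false]_(d <- poly_arc e) phi d.1 d.2 (+) (phi (ref_node e.1) (ref_node e.2) (+)
    (phi (ref_node e.1) (vertex_node e.1) (+) phi (ref_node e.2) (vertex_node e.2))).
Proof.
move=> sphi; rewrite big_cat /= big_cons big_nil addbF !big_map.
have -> : \big[addb/false]_(i <- iota 0 N) boundary_sum phi (ref_node e.1, arc_node e i, arc_node e i.+1) =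
   \big[addb/false]_(i <- iota 0 N) phi (arc_node e i) (arc_node e i.+1) (+)
   (phi (ref_node e.1) (vertex_node e.1) (+) phi (ref_node e.1) (vertex_node e.2)).
  have <- : phi (ref_node e.1) (arc_node e 0) (+) phi (ref_node e.1) (arc_node e N) = phi (ref_node e.1) (vertex_node e.1) (+) phi (ref_node e.1) (vertex_node e.2).
    by rewrite /arc_node eqxx; case: eqP N0 => [->|_ _]; rewrite ?ltnn ?eqxx.
  rewrite -(big_addb_telescope (fun i => phi (ref_node e.1) (arc_node e i))) -big_split /=.
  apply: eq_bigr => i _; rewrite /boundary_sum /=.
  by case: (phi (arc_node e i) _); rewrite ?addbF ?addFb // addbCA addTb.
rewrite /boundary_sum /=; set z := \big[_/_]_(_ <- _) _.
by case: z; case: (phi (ref_node e.1) (vertex_node e.1)); case: (phi (ref_node e.1) (vertex_node e.2));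
  case: (phi (ref_node e.1) (ref_node e.2)); case: (phi (ref_node e.2) (vertex_node e.2)).
Qed.

Lemma big_arcs (g : V -> bool) c : uniq c ->
  \big[addb/false]_(e <- arcs c) (g e.1 (+) g e.2) = false.
Proof. by move=> u; rewrite big_map /= big_next. Qed.

(** Around the cycle the edges joining reference copies to their vertices occur twice, and the
    chords of the strips cancel against the boundary of the fan. *)
Lemma disk_bounds c : uniq c -> (1 < size c)%N -> bounds (disk c) (poly_cycle c).
Proof.
move=> u s1 phi sphi; rewrite big_cat /= !big_flatten /= (big_map strip) (big_map poly_arc).
rewrite (big_map (fun t : V * V * V => (ref_node t.1.1, ref_node t.1.2, ref_node t.2))).
have -> : \big[addb/false]_(t <- cyc_fan c) boundary_sum phi (ref_node t.1.1, ref_node t.1.2, ref_node t.2) =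
    \big[addb/false]_(e <- arcs c) phi (ref_node e.1) (ref_node e.2).
  exact: (cyc_fan_bounds u s1 (phi := fun x y => phi (ref_node x) (ref_node y))).
under eq_bigr do rewrite strip_sum //.
rewrite !big_split /=.
set z := \big[_/_]_(_ <- _) \big[_/_]_(_ <- poly_arc _) _.
have -> : \big[addb/false]_(e <- arcs c) phi (ref_node e.1) (vertex_node e.1) (+)
   \big[addb/false]_(e <- arcs c) phi (ref_node e.2) (vertex_node e.2) = false.
  by rewrite -big_split /= (big_arcs (fun v => phi (ref_node v) (vertex_node v))).
set y := \big[_/_]_(_ <- _) phi _ _.
by case: z; case: y.
Qed.

Lemma poly_cycle_chain c : uniq c -> cycle_chain (poly_cycle c).
Proof.
move=> u g; rewrite big_flatten /= big_map -[RHS](big_arcs (fun v => g (vertex_node v)) u).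
apply: eq_bigr => e _; rewrite big_map (big_addb_telescope (fun i => g (arc_node e i))).
by rewrite /arc_node eqxx; case: eqP N0 => [->|_ _]; rewrite ?ltnn ?eqxx.
Qed.

(** Tells which vertices a node lies over, so that disjointness of cycles passes to the nodes of
    their disks. *)
Definition node_in (s : seq V) (y : node) : bool :=
  match y with
  | inl v => v \in s
  | inr (inl v) => v \in s
  | inr (inr (u, v, _)) => (u \in s) && (v \in s)
  end.

Lemma node_in_sub (s s' : seq V) y : {subset s <= s'} -> node_in s y -> node_in s' y.
Proof.
by move=> ss; case: y => [v|[v|[[u v] i]]] /=; [exact: ss|exact: ss|case/andP => /ss -> /ss ->].
Qed.

Lemma node_in_arc_node e i : node_in [:: e.1; e.2] (arc_node e i).
Proof. by rewrite /arc_node; case: ifP => _; [|case: ifP => _]; rewrite /= !inE !eqxx ?orbT. Qed.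

Lemma arc_node_neq e i : e.1 != e.2 -> (i < N)%N -> arc_node e i != arc_node e i.+1.
Proof.
move=> e12 iN; rewrite /arc_node /= (ltn_eqF iN); have [_|i0] := eqVneq i 0%N.
  by case: (i.+1 == N); first by apply: contra e12 => /eqP [->].
case: (eqVneq i.+1 N) => // iN1.
apply/eqP => -[/(congr1 val)]; rewrite /= !inordK ?ltnS ?(ltnW iN) //.
by move/eqP; rewrite ltn_eqF.
Qed.

Lemma ref_node_neq_arc_node v e i : ref_node v != arc_node e i.
Proof. by rewrite /arc_node; case: ifP => _; [|case: ifP => _]. Qed.

Lemma strip_vertices e T : e.1 != e.2 -> T \in strip e ->
  uniq (verts T) && all (node_in [:: e.1; e.2]) (verts T).
Proof.
move=> e12; rewrite mem_cat => /orP [/mapP [i]|].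
  rewrite mem_iota => /andP [_ iN] ->; rewrite /= !inE !negb_or !ref_node_neq_arc_node arc_node_neq // !node_in_arc_node.
  by rewrite eqxx.
rewrite inE => /eqP ->; rewrite /= !inE !negb_or !eqxx !orbT !andbT.
by apply: contra e12 => /eqP [->].
Qed.

Lemma arcs_sub c e : e \in arcs c -> {subset [:: e.1; e.2] <= c}.
Proof.
by move=> /mapP [u uc ->] x; rewrite !inE /= => /orP [] /eqP -> //; rewrite mem_next.
Qed.

Lemma disk_vertices c T : uniq c -> {in arcs c, forall e, e.1 != e.2} -> T \in disk c ->
  uniq (verts T) && all (node_in c) (verts T).
Proof.
move=> u irr; rewrite mem_cat => /orP [/flattenP [_ /mapP [e ec ->]]|/mapP [t tc ->]].
  move=> /(strip_vertices (irr e ec)) /andP [-> /allP h].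
  by apply/allP => x /h; apply: node_in_sub; exact: arcs_sub.
have /andP [u3 a3] := cyc_fan_vertices u tc.
rewrite -[verts _]/(map ref_node (verts t)) map_inj_uniq ?u3; last by move=> ? ? [].
by rewrite all_map.
Qed.

Lemma poly_cycle_vertices c d : {in arcs c, forall e, e.1 != e.2} -> d \in poly_cycle c ->
  [/\ d.1 != d.2, node_in c d.1 & node_in c d.2].
Proof.
move=> irr /flattenP [_ /mapP [e ec ->]] /mapP [i]; rewrite mem_iota => /andP [_ iN] -> /=.
by split; [exact: (arc_node_neq (irr e ec))| |]; apply: node_in_sub (node_in_arc_node _ _); exact: arcs_sub.
Qed.

Lemma node_in_disjoint (s s' : seq V) (t t' : seq node) : ~~ has (mem s) s' ->
  all (node_in s) t -> all (node_in s') t' -> ~~ has (mem t) t'.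
Proof.
move=> /hasPn ss /allP h /allP h'; apply/hasPn => y yt'; apply/negP => yt.
have := h _ yt; have := h' _ yt'.
case: y {yt yt'} => [v|[v|[[u v] i]]] /=; do ?by move=> /ss /negP.
by move=> /andP [/ss /negP us _] /andP [].
Qed.

Lemma uniq_disjoint (s s' : seq V) T T' : ~~ has (mem s) s' ->
  uniq (verts T) && all (node_in s) (verts T) -> uniq (verts T') && all (node_in s') (verts T') ->
  uniq (verts T ++ verts T').
Proof.
move=> ss /andP [u a] /andP [u' a'].
by rewrite cat_uniq u u' andbT; exact: node_in_disjoint ss a a'.
Qed.

Section Link.
Variables (R : realType) (p : node -> 'rV[R]_3).
Hypothesis gpp : general_position p.
Hypothesis pref : forall v, p (ref_node v) = moment R v.

Definition ref_cross (F : seq (node * node * node)) e : bool :=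
  \big[addb/false]_(T <- F) icross p T (ref_node e.1) (ref_node e.2).

Definition link c1 c2 : bool := crossings p (disk c1) (disk c2).

(** Expanding the crossings of two disks leaves, besides fan against fan, these terms: strip against
    strip, and each strip against the chord of the other arc. *)
Definition arc_cross (x : (V * V) * (V * V)) : bool :=
  crossings p (strip x.1) (strip x.2) (+) (ref_cross (strip x.1) x.2 (+) ref_cross (strip x.2) x.1).

Lemma arc_crossC e1 e2 : e1.1 != e1.2 -> e2.1 != e2.2 ->
  ~~ has (mem [:: e1.1; e1.2]) [:: e2.1; e2.2] -> arc_cross (e1, e2) = arc_cross (e2, e1).
Proof.
move=> i1 i2 dis; rewrite /arc_cross /= crossingsC // => [|T T' hT hT']; first by rewrite [X in _ (+) X]addbC.
by apply: (uniq_disjoint dis); exact: strip_vertices.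
Qed.

Definition arc_pairs c1 c2 : seq ((V * V) * (V * V)) :=
  [seq (e1, e2) | e1 <- arcs c1, e2 <- arcs c2].

(** The fan bounds the polygon of chords, so its crossings with the strips split into one term for
    each pair of arcs. *)
Lemma crossings_strips_fan c1 c2 : uniq c2 -> (1 < size c2)%N ->
  crossings p (strips c1) (ref_fan c2) =
  \big[addb/false]_(e1 <- arcs c1) \big[addb/false]_(e2 <- arcs c2) ref_cross (strip e1) e2.
Proof.
move=> u s1; rewrite (crossings_bounds _ _ (bounds_map ref_node (cyc_fan_bounds u s1))).
rewrite big_flatten /= big_map; apply: eq_bigr => e1 _.
rewrite exchange_big /= big_map; by apply: eq_bigr.
Qed.

(* The crossing terms depend on the arcs only, and by arc_crossC on their unordered pair. *)
Lemma linkE c1 c2 : uniq c1 -> uniq c2 -> (1 < size c1)%N -> (1 < size c2)%N ->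
  {in arcs c1, forall e, e.1 != e.2} -> {in arcs c2, forall e, e.1 != e.2} -> ~~ has (mem c1) c2 ->
  link c1 c2 = crossings p (ref_fan c1) (ref_fan c2) (+)
    \big[addb/false]_(x <- arc_pairs c1 c2) arc_cross x.
Proof.
move=> u1 u2 s1 s2 i1 i2 dis.
rewrite /link /disk crossings_catl !crossings_catr (crossingsC gpp (F := ref_fan c1) (F' := strips c2)); last first.
  move=> T T' hT hT'; apply: (uniq_disjoint dis).
    by apply: disk_vertices => //; rewrite mem_cat hT orbT.
  by apply: disk_vertices => //; rewrite mem_cat hT'.
rewrite !crossings_strips_fan // [X in _ (+) (X (+) _)]exchange_big /=.
have -> : crossings p (strips c1) (strips c2) =
   \big[addb/false]_(e1 <- arcs c1) \big[addb/false]_(e2 <- arcs c2) crossings p (strip e1) (strip e2).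
  rewrite /crossings big_flatten /= big_map; apply: eq_bigr => e1 _.
  under eq_bigr do rewrite big_flatten /= big_map.
  by rewrite exchange_big.
rewrite big_allpairs /= /arc_cross /=.
under [in RHS]eq_bigr do rewrite !big_split /=.
rewrite !big_split /=.
by rewrite addbA [RHS]addbC addbA.
Qed.

Definition ref_boundary_sum (T T' : V * V * V) : bool :=
  boundary_sum (fun x y : V => moment_cross T.1.1 T.1.2 T.2 x y) T'.

Definition ref_link c1 c2 : bool :=
  foldr addb false [seq ref_boundary_sum T T' | T <- cyc_fan c1, T' <- cyc_fan c2].

Lemma ref_linkE c1 c2 : uniq c1 -> uniq c2 -> ~~ has (mem c1) c2 ->
  crossings p (ref_fan c1) (ref_fan c2) = ref_link c1 c2.
Proof.
move=> u1 u2 dis.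
have -> : ref_link c1 c2 = \big[addb/false]_(T <- cyc_fan c1) \big[addb/false]_(T' <- cyc_fan c2) ref_boundary_sum T T'.
  have fE (l : seq bool) : foldr addb false l = \big[addb/false]_(b <- l) b.
    by elim: l => [|b l IH] /=; rewrite ?big_nil ?big_cons // IH.
  by rewrite /ref_link fE big_allpairs_dep.
rewrite /crossings big_map; apply: eq_big_seq => T hT; rewrite big_map; apply: eq_big_seq => T' hT'.
have /andP [uT aT] := cyc_fan_vertices u1 hT; have /andP [uT' aT'] := cyc_fan_vertices u2 hT'.
have u : uniq [seq val v | v <- verts T ++ verts T'].
  rewrite map_inj_uniq; last exact: val_inj.
  rewrite cat_uniq uT uT' andbT; apply/hasPn => y /(allP aT') /= yc2; apply/negP => /(allP aT) /= yc1.
  by move/hasPn: dis => /(_ _ yc2) /negP; apply.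
move: T T' {hT hT' uT aT uT' aT'} u => [[a b] c] [[d e] f] /= u.
rewrite /ref_boundary_sum /boundary_sum /icross /= !pref !cross_moment //; move: u; rewrite /= !inE !negb_or !andbT -!andbA;
  do ?[case/andP=> ?]; move=> ?; do ?[apply/andP; split=> //].
Qed.
End Link.
End Config.

(** * The tournament *)

(* The tournament and the list link_pairs were found by computer, solving the parity
   conditions over F_2 for random tournaments. *)
Definition out8 : seq (seq nat) :=
  [:: [:: 1; 3; 6]; [:: 2; 5; 6; 7]; [:: 0; 4; 5; 6]; [:: 1; 2; 5; 6; 7];
      [:: 0; 1; 3]; [:: 0; 4; 7]; [:: 4; 5]; [:: 0; 2; 4; 6]]%N.

Definition adj8 : rel 'I_8 := fun u v => (v : nat) \in nth [::] out8 u.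

Lemma adj8_irr : irreflexive adj8.
Proof.
have /allP h : all (fun u => u \notin nth [::] out8 u) (iota 0 8) by vm_compute.
by move=> u; apply/negbTE/h; rewrite mem_iota /=.
Qed.

Definition tournament8 : digraph 'I_8 := Digraph adj8_irr.

Lemma tournament8P : tournament tournament8.
Proof.
have /allP h : all (fun u => all (fun v => (u != v) ==>
    ((v \in nth [::] out8 u) (+) (u \in nth [::] out8 v))) (iota 0 8)) (iota 0 8) by vm_compute.
have in8 (w : 'I_8) : (w : nat) \in iota 0 8 by rewrite mem_iota /=.
by move=> u v uv; have /allP /(_ _ (in8 v)) /implyP := h _ (in8 u); apply.
Qed.

Definition link_pairs : seq (seq 'I_8 * seq 'I_8) :=
  let a := @Ordinal 8 0 isT in let b := @Ordinal 8 1 isT in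
  let c := @Ordinal 8 2 isT in let d := @Ordinal 8 3 isT in
  let e := @Ordinal 8 4 isT in let f := @Ordinal 8 5 isT in
  let g := @Ordinal 8 6 isT in let h := @Ordinal 8 7 isT in
  [:: ([:: c; f; h], [:: b; g; e]); ([:: d; g; e], [:: c; f; h]);
      ([:: a; b; c; f], [:: d; h; e]); ([:: a; b; h; c], [:: d; f; e]);
      ([:: a; b; g; e], [:: c; f; h]); ([:: a; b; f; h], [:: c; e; d]);
      ([:: a; d; c; f], [:: b; h; e]); ([:: a; d; h; c], [:: b; f; e]);
      ([:: a; d; g; e], [:: c; f; h]); ([:: a; d; f; h], [:: b; c; e]);
      ([:: b; c; f; e], [:: a; d; h]); ([:: b; h; c; e], [:: a; d; f]);
      ([:: b; f; h; e], [:: a; d; c]); ([:: c; f; e; d], [:: a; b; h]);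
      ([:: c; e; d; h], [:: a; b; f]); ([:: d; f; h; e], [:: a; b; c])].

Definition crossing_pairs := flatten [seq arc_pairs P.1 P.2 | P <- link_pairs].

(** A normal form for unordered pairs of arcs: the arc [(u, v)] has code [8 * u + v], and the
    smaller code comes first. *)
Definition sort_pair (x : ('I_8 * 'I_8) * ('I_8 * 'I_8)) :=
  if (x.1.1 * 8 + x.1.2 <= x.2.1 * 8 + x.2.2)%N then x else (x.2, x.1).

Lemma link_pairs_cycles P : P \in link_pairs ->
  [/\ directed_cycle tournament8 P.1, directed_cycle tournament8 P.2,
  (1 < size P.1)%N, (1 < size P.2)%N & ~~ has (mem P.1) P.2].
Proof.
have /allP h : all (fun P => [&& directed_cycle tournament8 P.1, directed_cycle tournament8 P.2,
  (1 < size P.1)%N, (1 < size P.2)%N & ~~ has (mem P.1) P.2]) link_pairs by vm_compute.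
by move=> /h /and5P.
Qed.

Lemma crossing_pairs_disjoint x : x \in crossing_pairs -> [&& x.1.1 != x.1.2, x.2.1 != x.2.2 &
  ~~ has (mem [:: x.1.1; x.1.2]) [:: x.2.1; x.2.2]].
Proof. by move: x; apply/allP; vm_compute. Qed.

Lemma crossing_pairs_even :
  all (fun x => ~~ odd (count_mem x (map sort_pair crossing_pairs))) (map sort_pair crossing_pairs).
Proof. by vm_compute. Qed.

Lemma link_pairs_ref_link : foldr addb false [seq ref_link P.1 P.2 | P <- link_pairs].
Proof. by vm_compute. Qed.

Lemma some_pair_linked (N : nat) (R : realType) (p : node 8 N -> 'rV[R]_3) : (0 < N)%N ->
  general_position p -> (forall v, p (ref_node N v) = moment R v) ->
  exists2 P, P \in link_pairs & link p P.1 P.2.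
Proof.
move=> N0 gpp pref; apply/hasP; apply/negPn/negP => /hasPn no.
have cyc_irr c : directed_cycle tournament8 c -> uniq c /\ {in arcs c, forall e, e.1 != e.2}.
  move=> /andP [_ /andP [cc uc]]; split => // _ /mapP [u hu ->] /=.
  by apply/eqP => uu; have := next_cycle cc hu; rewrite /= -uu adj8_irr.
have E : \big[addb/false]_(P <- link_pairs) link p P.1 P.2 =
  \big[addb/false]_(P <- link_pairs) ref_link P.1 P.2 (+)
  \big[addb/false]_(x <- crossing_pairs) arc_cross p x.
  rewrite /crossing_pairs big_flatten (big_map (fun P => arc_pairs P.1 P.2)) -big_split.
  apply: eq_big_seq => P hP.
  have [d1 d2 s1 s2 dis] := link_pairs_cycles hP.
  have [u1 i1] := cyc_irr _ d1; have [u2 i2] := cyc_irr _ d2.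
  by rewrite linkE // (ref_linkE pref).
have : \big[addb/false]_(x <- crossing_pairs) arc_cross p x = false.
  (* Sorting a pair leaves its term unchanged, by [arc_crossC], and each sorted pair occurs an even
     number of times. *)
  rewrite -[RHS](big_addb_even (arc_cross p) crossing_pairs_even) big_map.
  apply: eq_big_seq => x /crossing_pairs_disjoint /and3P [h1 h2 h3].
  rewrite /sort_pair; case: ifP => // _; case: x h1 h2 h3 => e1 e2 /= h1 h2 h3.
  exact: arc_crossC.
have fE (l : seq bool) : foldr addb false l = \big[addb/false]_(b <- l) b.
  by elim: l => [|b l IH] /=; rewrite ?big_nil ?big_cons // IH.
have : \big[addb/false]_(P <- link_pairs) ref_link P.1 P.2.
  by rewrite -(big_map (fun P => ref_link P.1 P.2) predT id) -fE; exact: link_pairs_ref_link.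
move=> r0 r1; move: E; rewrite r0 r1 big1_seq // => P /= hP.
by apply/negbTE; exact: no.
Qed.

(** * From embeddings to polygons *)

Lemma seq_min_pos (R : realType) (T : eqType) (s : seq T) (Q : T -> R -> Prop) :
  (forall x d d', d' <= d -> Q x d -> Q x d') ->
  (forall x, x \in s -> exists2 d, 0 < d & Q x d) ->
  exists2 d, 0 < d & forall x, x \in s -> Q x d.
Proof.
move=> Qle; elim: s => [|y s IH] h; first by exists 1.
have [|d d0 hd] := IH; first by move=> x xs; apply: h; rewrite inE xs orbT.
have [|d' d'0 hd'] := h y; first by rewrite inE eqxx.
exists (Num.min d d'); first by rewrite lt_min d0.
move=> x; rewrite inE => /orP [/eqP ->|xs].
  by apply: Qle hd'; rewrite ge_min lexx orbT.
by apply: Qle (hd x xs); rewrite ge_min lexx.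
Qed.

Lemma polyhedron1_lines (R : realType) n (X : set 'rV[R]_n) : polyhedron 1 X ->
  exists lines : seq ('rV[R]_n * 'rV[R]_n), forall x, X x ->
    exists2 l, l \in lines & exists t, x = l.1 + t *: (l.2 - l.1).
Proof.
move=> [F finF ->].
have /finite_seqP [lines linesE] := finite_image (fun p : 'I_2 -> 'rV[R]_n => (p ord0, p ord_max)) finF.
exists lines => _ [p Fp [w [_ w1 ->]]]; exists (p ord0, p ord_max).
  have : [set` lines] (p ord0, p ord_max) by rewrite -linesE; exists p.
  by [].
exists (w ord_max); move: w1; rewrite !big_ord_recl !big_ord0 !addr0.
have -> : lift ord0 ord0 = ord_max :> 'I_2 by apply: val_inj.
move=> w1; have -> : w ord0 = 1 - w ord_max by rewrite -w1 addrK.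
by rewrite scalerBl scale1r scalerBr addrA addrAC.
Qed.

Section Glue.
Variables (R : realType) (V : finType) (G : digraph V).
Variables (f : V -> 'rV[R]_4) (gamma : V -> V -> R -> 'rV[R]_4).
Hypothesis se : spatial_embedding G f gamma.

Lemma directed_arc c u : directed_cycle G c -> u \in c -> G u (next c u).
Proof. by move=> /andP [_ /andP [cc _]] uc; exact: next_cycle. Qed.

Lemma arc_point u v t : 0 <= t <= 1 -> arc_image gamma u v (gamma u v t).
Proof. by move=> t01; exists t => //=; rewrite in_itv. Qed.

Lemma cycle_image_compact c : directed_cycle G c -> compact (cycle_image gamma c).
Proof.
move=> dc; rewrite /cycle_image bigcup_seq big_seq.
elim/big_ind: _ => [|A B cA cB|u uc]; [exact: compact0|exact: compactU|].
have [_ [cg _ _]] := arc_embedding se (directed_arc dc uc).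
by apply: continuous_compact => //; exact: segment_compact.
Qed.

Lemma arc_connected (S : set 'rV[R]_4) u v s t : G u v -> arc_image gamma u v `&` S = set0 ->
  0 <= s <= 1 -> 0 <= t <= 1 ->
  connected_component (sphere R 3 `\` S) (gamma u v s) (gamma u v t).
Proof.
move=> uv dis s01 t01; have [sub [cg _ _]] := arc_embedding se uv.
exists (arc_image gamma u v); last exact: arc_point.
split; first exact: arc_point.
  move=> x ax; split; first exact: sub.
  by move=> Sx; rewrite -[False]/(set0 x) -dis.
by apply: connected_continuous_connected => //; exact: segment_connected.
Qed.

Lemma cycle_connected (S : set 'rV[R]_4) c x y : directed_cycle G c ->
  cycle_image gamma c `&` S = set0 -> cycle_image gamma c x -> cycle_image gamma c y ->
  connected_component (sphere R 3 `\` S) x y.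
Proof.
move=> dc dis.
have disu u : u \in c -> arc_image gamma u (next c u) `&` S = set0.
  move=> uc; rewrite -subset0 -dis => z [az Sz]; split => //.
  by exists u.
have z01 : 0 <= (0 : R) <= 1 by rewrite lexx ler01.
have o01 : 0 <= (1 : R) <= 1 by rewrite lexx ler01.
have step u : u \in c -> connected_component (sphere R 3 `\` S) (f u) (f (next c u)).
  move=> uc; have uv := directed_arc dc uc.
  by rewrite -(arc_source se uv) -(arc_target se uv); apply: arc_connected => //; exact: disu.
have tocyc z : cycle_image gamma c z -> exists2 u, u \in c &
    connected_component (sphere R 3 `\` S) (f u) z.
  move=> [u /= uc [t /= t01 <-]]; exists u => //; have uv := directed_arc dc uc.
  rewrite -(arc_source se uv); apply: arc_connected => //; first exact: disu.
have [c0 [s cE]] : exists c0 s, c = c0 :: s.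
  by case: (c) dc => // c0 s _; exists c0, s.
have uc : uniq c by case/andP: dc => _ /andP [].
have all0 u : u \in c -> connected_component (sphere R 3 `\` S) (f c0) (f u).
  move=> hu; have iu : (index u c < size c)%N by rewrite index_mem.
  rewrite -[u](nth_index c0 hu); elim: (index u c) iu => [_|i IH iu].
    rewrite cE /=; apply: connected_component_refl; split; first exact: (vertex_in se).
    move=> Sx; have c0c : c0 \in c by rewrite cE inE eqxx.
    suff : (arc_image gamma c0 (next c c0) `&` S) (f c0) by rewrite disu.
    split => //; rewrite -(arc_source se (directed_arc dc c0c)).
    exact: arc_point.
  apply: connected_component_trans (IH (ltnW iu)) _.
  have -> : nth c0 c i.+1 = next c (nth c0 c i).
    rewrite -(nth_map c0 c0 (next c)) ?(ltnW iu) // map_next_rot // /rot nth_cat size_drop.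
    by rewrite ltn_subRL add1n iu nth_drop.
  by apply: step; rewrite mem_nth // ltnW.
move=> /tocyc [u hu ux] /tocyc [v hv vy].
apply: connected_component_trans vy.
apply: connected_component_trans (all0 v hv).
apply: connected_component_trans (connected_component_sym (all0 u hu)).
exact: connected_component_sym.
Qed.

Lemma split_pair (q : 'rV[R]_4) (h : 'rV[R]_4 -> 'rV[R]_3) c1 c2 :
  homeomorphism (sphere R 3 `\ q) [set: 'rV[R]_3] h ->
  (forall X, [set X | exists u v, G u v /\ X = arc_image gamma u v] X ->
     ~ X q /\ polyhedron 1 (h @` X)) ->
  directed_cycle G c1 -> directed_cycle G c2 ->
  split_link [set cycle_image gamma c | c in [set` [:: c1; c2]]] ->
  fine_unlinked (h @` cycle_image gamma c1) (h @` cycle_image gamma c2).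
Proof.
move=> hh hX d1 d2 [S [[[s se' SE] _] dis [K1 [K2 [LK1 LK2 sepK]]]]].
have P1 : cycle_image gamma c1 `&` S = set0 by apply: dis; exists c1 => //=; rewrite inE eqxx.
have P2 : cycle_image gamma c2 `&` S = set0.
  by apply: dis; exists c2 => //=; rewrite !inE eqxx orbT.
have sub c : directed_cycle G c -> cycle_image gamma c `<=` sphere R 3 `\ q.
  move=> dc x [u /= uc ax]; have uv := directed_arc dc uc; split.
    by have [sub _] := arc_embedding se uv; exact: sub.
  by move=> xq; have [+ _] := hX _ (ex_intro _ u (ex_intro _ _ (conj uv erefl))); rewrite -xq.
have nonempty c : directed_cycle G c -> exists x, cycle_image gamma c x.
  case: c => // u c dc; exists (gamma u (next (u :: c) u) 0), u; first by rewrite /= inE eqxx.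
  by apply: arc_point; rewrite lexx ler01.
have [x1 X1] := nonempty _ d1; have [x2 X2] := nonempty _ d2.
have [A hA] : {A : V * V -> seq ('rV[R]_3 * 'rV[R]_3) & forall e, G e.1 e.2 ->
    forall x, (h @` arc_image gamma e.1 e.2) x ->
    exists2 l, l \in A e & exists t, x = l.1 + t *: (l.2 - l.1)}.
  apply: (@choice _ _ (fun (e : V * V) A => G e.1 e.2 ->
    forall x, (h @` arc_image gamma e.1 e.2) x ->
    exists2 l, l \in A & exists t, x = l.1 + t *: (l.2 - l.1))) => e.
  have [uv|nuv] := pselect (G e.1 e.2); last by exists [::].
  have [_ /polyhedron1_lines [A hA]] := hX _ (ex_intro _ e.1 (ex_intro _ e.2 (conj uv erefl))).
  by exists A => _; exact: hA.
apply: (@split_fine R q h _ _ S s (flatten [seq A (u, next c1 u) | u <- c1]) x1) => //.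
- exact: cycle_image_compact.
- exact: cycle_image_compact.
- exact: sub.
- exact: sub.
- by move=> x hx; apply: cycle_connected X1 hx.
(* The separated components [K1] and [K2] may be given in either order, and if both were the same
   cycle, its connectedness would contradict the separation. *)
- move=> y hy xy; case: LK1 => c /= hc1; case: LK2 => c' /= hc2 E2 E1.
  move: sepK; rewrite -E1 -E2 => sepK.
  move: hc1 hc2; rewrite !inE => /orP [] /eqP cE /orP [] /eqP cE'; move: sepK; rewrite cE cE' => sepK.
  + by apply: (sepK x1 x1 X1 X1); exact: (cycle_connected d1 P1 X1 X1).
  + exact: (sepK x1 y X1 hy xy).
  + by apply: (sepK y x1 hy X1); exact: connected_component_sym.
  + by apply: (sepK x2 x2 X2 X2); exact: (cycle_connected d2 P2 X2 X2).
- move=> x [u /= uc ax]; have uv := directed_arc d1 uc.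
  have [|l lA lx] := hA (u, next c1 u) uv (h x); first by exists x.
  exists l => //; apply/flattenP; exists (A (u, next c1 u)) => //.
  exact: map_f.
Qed.
End Glue.

Theorem theorem2p3 (R : realType) :
  exists G : digraph 'I_8, tournament G /\ intrinsically_linked R G.
Proof.
exists tournament8; split; first exact: tournament8P.
move=> f gamma [se [q [h [sq hh hX]]]].
apply: contrapT => hno.
(* If no link is non-split, each listed pair is split, and its fine polygons are unlinked. *)
have hsplit P : P \in link_pairs -> exists2 e, 0 < e &
    unlinked_at (h @` cycle_image gamma P.1) (h @` cycle_image gamma P.2) e.
  move=> hP; have [d1 d2 _ _ dis] := link_pairs_cycles hP.
  apply: (split_pair se hh hX d1 d2); apply: contrapT => ns; apply: hno.
  exists [:: P.1; P.2]; split => //=; first by rewrite d1 d2.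
  by rewrite dis.
have [e e0 he] := seq_min_pos (fun P d d' => @unlinked_at_le R _ _ d d') hsplit.
(* Both ends of an edge of the second polygon must lie within [e] of one point of the cycle; the
   second end is off by a perturbation and a subdivision step, hence the half. *)
pose e2 := e / 2; have e20 : 0 < e2 by rewrite divr_gt0.
have ch : cont_on (sphere R 3 `\ q) h by case: hh => /cont_onP.
have arc_sub u v t : tournament8 u v -> 0 <= t <= 1 -> (sphere R 3 `\ q) (gamma u v t).
  move=> uv t01; have ap := @arc_point R _ gamma u v t t01.
  have [sub _] := arc_embedding se uv; split; first exact: sub.
  by move=> tq; have [+ _] := hX _ (ex_intro _ u (ex_intro _ v (conj uv erefl))); rewrite -tq.
have unif (a : 'I_8 * 'I_8) : a \in enum [pred a : 'I_8 * 'I_8 | tournament8 a.1 a.2] -> exists2 d, 0 < d &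
    forall s t : R, 0 <= s <= 1 -> 0 <= t <= 1 -> `|s - t| < d ->
      `|h (gamma a.1 a.2 s) - h (gamma a.1 a.2 t)| < e2.
  rewrite mem_enum inE => av; have [_ [/cont_onP cg _ _]] := arc_embedding se av.
  have cc : cont_on (`[0, 1] : set R) (h \o gamma a.1 a.2).
    apply: (cont_on_comp cg ch) => _ [t /= t01 <-]; apply: arc_sub => //.
  have [d d0 hd] := cont_on_unif (@segment_compact R 0 1) cc e20.
  by exists d => // s t s01 t01; apply: hd; rewrite /= in_itv.
have [|d d0 hd] := seq_min_pos _ unif.
  by move=> a d d' dd H s t s01 t01 st; apply: H => //; exact: lt_le_trans dd.
pose N := (Num.bound d^-1).+1.
have N0 : (0 < N)%N by [].
have Nd : N%:R^-1 < d.
  rewrite -[d]invrK ltf_pV2 ?posrE ?invr_gt0 ?ltr0n //.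
  have b0 : 0 <= d^-1 by rewrite invr_ge0 ltW.
  by apply: lt_le_trans (archi_boundP b0) _; rewrite ler_nat.
(* The reference points may lie anywhere relative to the image of the graph, since the contributions
   of the strips cancel. *)
pose k (y : node 8 N) : 'rV[R]_3 :=
  match y with
  | inl v => moment R v
  | inr (inl v) => h (f v)
  | inr (inr (u, v, i)) => h (gamma u v (i%:R / N%:R))
  end.
pose fixed (y : node 8 N) := if y is inl _ then true else false.
have fixedP y : fixed y -> exists v, y = ref_node N v by case: y => // v; exists v.
have card8 : (3 < #|fixed|)%N.
  apply: (@leq_trans #|'I_8|); first by rewrite card_ord.
  rewrite -(card_codom (f := @ref_node 8 N)); last by move=> x y [].
  by apply/subset_leq_card/fintype.subsetP => _ /codomP [x ->].
have gk : general_position_on (enum fixed) k.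
  move=> i j l o; rewrite !mem_enum => /fixedP [x ->] /fixedP [y ->] /fixedP [z ->] /fixedP [t ->] u.
  apply: orient_moment_neq0; move: u.
  rewrite -[ [:: _; _; _; _] ]/(map (@ref_node 8 N) [:: x; y; z; t]) map_inj_uniq; last by move=> ? ? [].
  by rewrite -(map_inj_uniq val_inj).
have [p [pf pe gpp]] := general_position_extend e20 card8 gk.
have [P hP] := some_pair_linked N0 gpp (fun v => pf (ref_node N v) isT).
have [d1 d2 s1 s2 dis] := link_pairs_cycles hP.
have cyc_irr c : directed_cycle tournament8 c -> uniq c /\ {in arcs c, forall e, e.1 != e.2}.
  move=> dc; split; first by case/andP: dc => _ /andP [].
  move=> _ /mapP [u hu ->] /=; apply/eqP => uu.
  by have := directed_arc dc hu; rewrite /= -uu adj8_irr.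
have [u1 i1] := cyc_irr _ d1; have [u2 i2] := cyc_irr _ d2.
have kpt a i : tournament8 a.1 a.2 -> (i <= N)%N -> k (arc_node N a i) = h (gamma a.1 a.2 (i%:R / N%:R)).
  move=> av iN; rewrite /arc_node; case: eqP => [->|_]; first by rewrite mul0r (arc_source se av).
  case: eqP => [->|_]; first by rewrite divff ?pnatr_eq0 // (arc_target se av).
  by rewrite /= inordK.
have polyP c z : directed_cycle tournament8 c -> z \in poly_cycle N c ->
  [/\ (h @` cycle_image gamma c) (k z.1), (h @` cycle_image gamma c) (k z.2) & `|k z.1 - k z.2| < e2].
  move=> dc /flattenP [_ /mapP [a /mapP [u uc aE] ->]] /mapP [i]; rewrite mem_iota => /andP [_ iN] -> /=.
  have av : tournament8 a.1 a.2 by rewrite aE; exact: directed_arc.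
  have t01 j : (j <= N)%N -> 0 <= (j%:R / N%:R : R) <= 1.
    by move=> jN; rewrite divr_ge0 ?ler0n //= ler_pdivrMr ?ltr0n // mul1r ler_nat.
  have iN' : (i <= N)%N by exact: ltnW.
  rewrite !kpt //; split.
  - exists (gamma a.1 a.2 (i%:R / N%:R)) => //; exists u => //.
    by rewrite aE; apply: arc_point; exact: t01.
  - exists (gamma a.1 a.2 (i.+1%:R / N%:R)) => //; exists u => //.
    by rewrite aE; apply: arc_point; exact: t01.
  - apply: (hd a); rewrite ?mem_enum ?inE //; try exact: t01.
    rewrite -mulrBl -[i.+1]addn1 natrD opprD addrA subrr sub0r mulN1r normrN.
    by rewrite ger0_norm ?invr_ge0 ?ler0n.
(* The roles are exchanged so that the disk of the second cycle meets the polygon of the first, as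
   in [unlinked_at]. *)
rewrite /link crossingsC //; last first.
  move=> T T' hT hT'; apply: (uniq_disjoint dis); exact: disk_vertices.
rewrite (crossings_bounds _ _ (disk_bounds N0 u1 s1)).
have e2e : e2 < e by rewrite /e2; lra.
rewrite (he P hP _ p k (poly_cycle N P.1) (poly_cycle N P.2)) //.
- by apply: leq_trans card8 _; exact: max_card.
- exact: poly_cycle_chain.
- move=> z hz; have [z1 z2 z12] := polyP _ _ d1 hz; have [zz _ _] := poly_cycle_vertices i1 hz.
  have pe' y : `|p y - k y| < e by exact: lt_trans (pe y) e2e.
  by split => //; exact: lt_trans e2e.
- move=> z hz; have [z1 z2 z12] := polyP _ _ d2 hz; exists (k z.1) => //; split.
    exact: lt_trans (pe _) e2e.
  rewrite -[p z.2](subrK (k z.2)) -addrA; apply: le_lt_trans (ler_normD _ _) _.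
  rewrite [`|k z.2 - _|]distrC; have := pe z.2; move: z12; rewrite /e2; lra.
- exact: disk_bounds.
- move=> T z hT hz; have [zz c1 c2] := poly_cycle_vertices i1 hz.
  have /andP [uT aT] := disk_vertices u2 i2 hT.
  have dis' : ~~ has (mem P.2) P.1 by rewrite has_sym.
  have a2 : all (node_in P.1) [:: z.1; z.2] by rewrite /= c1 c2.
  by rewrite cat_uniq uT (node_in_disjoint dis' aT a2) /= inE zz.
Qed.
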